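(* ML-VDISJ-PATH with $p\ge 2$ source-sink pairs is polynomially reducible to ML-CAP-STEINER-TREE with $p^2$ terminals and uniform capacity $p$ (that is, $c(e)=p$ for every $e\in E$). (This holds for undirected graphs, and likewise for directed graphs.)
   Context: Graphs $G=(V,E)$ are finite and may be directed or undirected; ''path'' means directed path in the directed case. ML-CAP-STEINER-TREE. Input: a connected graph $G=(V,E)$; a set $T\subset V$ of $K\ge 2$ terminals; a root $r\in V\setminus T$ (if $G$ is directed, there is a directed path from $r$ to every vertex of $V$); a nonnegative rational length $\ell(e)$ and a positive integer capacity $c(e)$ for every $e\in E$. Objective: determine, if one exists, a tree $S$ in $G$, directed away from its root $r$, that spans all vertices of $T$ (it need not span $V$), satisfies the capacity constraints, and has minimum total length. The capacity constraints say: for every arc $e=(u,v)$ of $S$, the subtree of $S$ rooted at $v$ contains at most $c(e)$ terminals. If $G$ is undirected, an arc $(u,v)$ of $S$ must be such that $[u,v]\in E$, and it has the length and capacity of that edge. ML-VDISJ-PATH. Input: a graph $G=(V,E)$; a nonnegative length function $\ell$ on $E$; $p$ disjoint vertex pairs (source-sink pairs) $(s_1,s'_1),\dots,(s_p,s'_p)$. Objective: find, if they exist, $p$ mutually vertex-disjoint paths $\mu_1,\dots,\mu_p$ of minimum total length such that $\mu_i$ links $s_i$ to $s'_i$ for $i=1,\dots,p$. ''Polynomially reducible'' here means: there is a polynomial-time transformation of instances $I$ of the first problem into instances $I'$ of the second (of the indicated form) such that $I$ is feasible if and only if $I'$ is, and any optimal solution of $I'$ can be converted in polynomial time into an optimal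 solution of $I$. *)

(* Defs.v *)
From Corelib Require Import BinNums.
From mathcomp Require Import all_boot all_order all_algebra.
Set Implicit Arguments.
Unset Strict Implicit.
Unset Printing Implicit Defensive.

Import GRing.Theory Num.Theory.

(* [tm] below is a deterministic multi-tape Turing machine over the tape
   alphabet {0, 1, blank}, with [None] as the blank. *)
Notation cell := (option bool).
Notation word := (seq bool).

Inductive move := MoveL | Stay | MoveR.

(* The tape is infinite in both directions: [tape_left] lists the cells to the
   left of the head, nearest first, [tape_right] those to its right, and all
   unlisted cells are blank. *)
Record tape := Tape {
  tape_left : seq cell;
  tape_head : cell;
  tape_right : seq cell
}.

Definition write (c : cell) (t : tape) : tape :=
  Tape (tape_left t) c (tape_right t).

Definition shift (m : move) (t : tape) : tape :=
  let: Tape l c r := t in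
  match m with
  | MoveL => Tape (behead l) (head None l) (c :: r)
  | Stay => t
  | MoveR => Tape (c :: l) (head None r) (behead r)
  end.

(* There are [tm_tapes.+1] tapes, so that the first one always exists. *)
Record tm := TM {
  tm_tapes : nat;
  tm_state : finType;
  tm_start : tm_state;
  tm_halt : pred tm_state;
  tm_trans : tm_state -> {ffun 'I_tm_tapes.+1 -> cell} ->
             tm_state * {ffun 'I_tm_tapes.+1 -> cell * move}
}.

Definition tm_config (M : tm) : Type :=
  (tm_state M * {ffun 'I_(tm_tapes M).+1 -> tape})%type.

(* A halted configuration steps to itself. *)
Definition tm_step (M : tm) (c : tm_config M) : tm_config M :=
  let: (q, ts) := c in
  if tm_halt q then c else
  let: (q', acts) := tm_trans q [ffun i => tape_head (ts i)] in
  (q', [ffun i => shift (acts i).2 (write (acts i).1 (ts i))]).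

Definition word_tape (w : word) : tape :=
  let s := map Some w in Tape [::] (head None s) (behead s).

Definition tm_init (M : tm) (w : word) : tm_config M :=
  (tm_start M, [ffun i => word_tape (if i == ord0 then w else [::])]).

Fixpoint bits_before_blank (s : seq cell) : word :=
  if s is Some b :: s' then b :: bits_before_blank s' else [::].

(* The output is read on the first tape, from the head to the next blank. *)
Definition tm_output (M : tm) (c : tm_config M) : word :=
  let t := c.2 ord0 in bits_before_blank (tape_head t :: tape_right t).

Definition tm_computes_within (M : tm) (w y : word) (t : nat) : Prop :=
  let c := iter t (@tm_step M) (tm_init M w) in
  tm_halt c.1 /\ tm_output c = y.

(* The map sending the object coded by [inp x] to the object coded by [out x],
   for [x] in [D], is computable in time polynomial in the size of [inp x]. *)
Definition poly_time (X : Type) (D : X -> Prop) (inp out : X -> word) : Prop :=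
  exists (M : tm) (q : {poly nat}), forall x, D x ->
    tm_computes_within M (inp x) (out x) (horner q (size (inp x))).

(* Data are represented by binary trees, written in prefix order. *)
Inductive tree := Leaf | Node of tree & tree.

Fixpoint code (t : tree) : word :=
  if t is Node l r then true :: code l ++ code r else [:: false].

Definition tree_seq (s : seq tree) : tree := foldr Node Leaf s.

(* Unary; used for the number of vertices and for vertex names only. *)
Definition tree_unary (n : nat) : tree := tree_seq (nseq n Leaf).

Definition tree_bool (b : bool) : tree := if b then Node Leaf Leaf else Leaf.

Fixpoint positive_bits (m : positive) : seq bool :=
  match m with
  | xH => [:: true]
  | xO m' => false :: positive_bits m'
  | xI m' => true :: positive_bits m'
  end.

(* Binary, least significant bit first; used for lengths and capacities. *)
Definition tree_binary (n : nat) : tree :=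
  tree_seq (map tree_bool
    (if bin_of_nat n is Npos m then positive_bits m else [::])).

(* Lengths are nonnegative, hence no sign. *)
Definition tree_rat (x : rat) : tree :=
  Node (tree_binary `|numq x|%N) (tree_binary `|denq x|%N).

Record opt_problem := OptProblem {
  instance : Type;
  legal : instance -> Prop;
  candidate : instance -> Type;
  feasible_sol : forall I : instance, candidate I -> Prop;
  cost : forall I : instance, candidate I -> rat;
  tree_instance : instance -> tree;
  tree_candidate : forall I : instance, candidate I -> tree
}.

Definition feasible (P : opt_problem) (I : instance P) : Prop :=
  exists s : candidate I, feasible_sol s.

Definition optimal (P : opt_problem) (I : instance P) (s : candidate I) : Prop :=
  feasible_sol s /\
  forall s' : candidate I, feasible_sol s' -> (cost s <= cost s')%R.

(* Reduction of the legal instances [I] of [P] satisfying [dom I] to instances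
   [f I] of [Q] such that [form I (f I)]; [g] is the conversion of solutions,
   which receives the original instance together with an optimal solution of
   the transformed one. *)
Definition poly_reducible (P Q : opt_problem) (dom : instance P -> Prop)
    (form : instance P -> instance Q -> Prop) : Prop :=
  exists (f : instance P -> instance Q)
         (g : forall I : instance P, candidate (f I) -> candidate I),
  let D I := legal I /\ dom I in
  [/\ poly_time D (fun I => code (tree_instance I))
                  (fun I => code (tree_instance (f I))),
      poly_time (fun x : {I : instance P & candidate (f I)} =>
                   D (projT1 x) /\ optimal (projT2 x))
                (fun x => code (Node (tree_instance (projT1 x))
                                     (tree_candidate (projT2 x))))
                (fun x => code (tree_candidate (g (projT1 x) (projT2 x))))
    & forall I, D I ->
        [/\ legal (f I), form I (f I),
            feasible I <-> feasible (f I)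
          & forall S : candidate (f I), optimal S -> optimal (g I S)]].

(* The vertices are ['I_nverts].  An undirected graph is a symmetric set of
   arcs: the edge [u, v] is present as both (u, v) and (v, u).  The values of
   [len] outside [arcs] are irrelevant. *)
Record lgraph := LGraph {
  nverts : nat;
  arcs : {set 'I_nverts * 'I_nverts};
  len : {ffun 'I_nverts * 'I_nverts -> rat}
}.

Notation vertex G := 'I_(nverts G).

Definition arc_rel (n : nat) (A : {set 'I_n * 'I_n}) : rel 'I_n :=
  [rel u v | (u, v) \in A].

Definition lgraph_legal (directed : bool) (G : lgraph) : Prop :=
  [/\ forall u : vertex G, (u, u) \notin arcs G,
      forall e, e \in arcs G -> (0 <= len G e)%R
    & ~~ directed -> forall u v : vertex G, (u, v) \in arcs G ->
        (v, u) \in arcs G /\ len G (v, u) = len G (u, v)].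

Definition tree_vertex (n : nat) (v : 'I_n) : tree := tree_unary v.

Definition tree_arc (n : nat) (e : 'I_n * 'I_n) : tree :=
  Node (tree_vertex e.1) (tree_vertex e.2).

Definition tree_lgraph (G : lgraph) : tree :=
  Node (tree_unary (nverts G))
    (tree_seq [seq Node (tree_arc e) (tree_rat (len G e)) | e <- enum (arcs G)]).

Record vdp_instance := VDP {
  vdp_graph : lgraph;
  vdp_num : nat;
  vdp_pairs : vdp_num.-tuple (vertex vdp_graph * vertex vdp_graph)
}.

(* The 2p sources and sinks are pairwise distinct. *)
Definition vdp_legal (directed : bool) (I : vdp_instance) : Prop :=
  lgraph_legal directed (vdp_graph I) /\
  uniq (unzip1 (vdp_pairs I) ++ unzip2 (vdp_pairs I)).

(* A path is given by the sequence of all its vertices, end points included. *)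
Definition links (n : nat) (A : {set 'I_n * 'I_n}) (x y : 'I_n)
    (w : seq 'I_n) : Prop :=
  exists w', [/\ w = x :: w', path (arc_rel A) x w', last x w' = y & uniq w].

Definition path_len (G : lgraph) (w : seq (vertex G)) : rat :=
  (\sum_(e <- zip w (behead w)) len G e)%R.

Definition vdp_candidate (I : vdp_instance) : Type :=
  (vdp_num I).-tuple (seq (vertex (vdp_graph I))).

Definition vdp_feasible (I : vdp_instance) (mu : vdp_candidate I) : Prop :=
  (forall i, links (arcs (vdp_graph I)) (tnth (vdp_pairs I) i).1
                   (tnth (vdp_pairs I) i).2 (tnth mu i)) /\
  (forall i j, i != j -> [disjoint tnth mu i & tnth mu j]).

Definition vdp_cost (I : vdp_instance) (mu : vdp_candidate I) : rat :=
  (\sum_(i < vdp_num I) path_len (tnth mu i))%R.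

Definition tree_vdp (I : vdp_instance) : tree :=
  Node (tree_lgraph (vdp_graph I)) (tree_seq (map (@tree_arc _) (vdp_pairs I))).

Definition tree_vdp_candidate (I : vdp_instance) (mu : vdp_candidate I) : tree :=
  tree_seq [seq tree_seq (map (@tree_vertex _) w) | w : seq _ <- mu].

Definition ml_vdisj_path (directed : bool) : opt_problem :=
  @OptProblem vdp_instance (vdp_legal directed) vdp_candidate
    vdp_feasible vdp_cost tree_vdp tree_vdp_candidate.

Record cst_instance := CST {
  cst_graph : lgraph;
  cst_cap : {ffun vertex cst_graph * vertex cst_graph -> nat};
  cst_terminals : {set vertex cst_graph};
  cst_root : vertex cst_graph
}.

(* In the directed case, connectedness follows from the condition on the
   root. *)
Definition cst_legal (directed : bool) (I : cst_instance) : Prop :=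
  let G := cst_graph I in
  [/\ lgraph_legal directed G,
      (forall e, e \in arcs G -> 0 < cst_cap I e) /\
      (~~ directed -> forall u v : vertex G, (u, v) \in arcs G ->
         cst_cap I (v, u) = cst_cap I (u, v)),
      if directed then forall v, connect (arc_rel (arcs G)) (cst_root I) v
      else forall u v, connect (arc_rel (arcs G)) u v,
      2 <= #|cst_terminals I|
    & cst_root I \notin cst_terminals I].

(* Trees directed away from the root are represented by their arcs. *)
Definition spanned (n : nat) (r : 'I_n) (S : {set 'I_n * 'I_n}) : {set 'I_n} :=
  r |: [set e.1 | e in S] :|: [set e.2 | e in S].

(* There is exactly one directed walk from the root to each vertex. *)
Definition out_tree (n : nat) (r : 'I_n) (S : {set 'I_n * 'I_n}) : Prop :=
  forall v, v \in spanned r S ->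
    exists! w, path (arc_rel S) r w /\ last r w = v.

Definition cst_candidate (I : cst_instance) : Type :=
  {set vertex (cst_graph I) * vertex (cst_graph I)}.

(* The vertices of the subtree of [S] rooted at [v] are those reachable from
   [v] in [S]. *)
Definition cst_feasible (I : cst_instance) (S : cst_candidate I) : Prop :=
  [/\ S \subset arcs (cst_graph I),
      out_tree (cst_root I) S,
      cst_terminals I \subset spanned (cst_root I) S
    & forall u v, (u, v) \in S ->
        #|[set t in cst_terminals I | connect (arc_rel S) v t]|
          <= cst_cap I (u, v)].

Definition cst_cost (I : cst_instance) (S : cst_candidate I) : rat :=
  (\sum_(e in S) len (cst_graph I) e)%R.

(* The capacities are listed in the same order as the arcs. *)
Definition tree_cst (I : cst_instance) : tree :=
  Node (tree_lgraph (cst_graph I))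
    (Node (tree_seq [seq tree_binary (cst_cap I e) | e <- enum (arcs (cst_graph I))])
      (Node (tree_seq (map (@tree_vertex _) (enum (cst_terminals I))))
        (tree_vertex (cst_root I)))).

Definition tree_cst_candidate (I : cst_instance) (S : cst_candidate I) : tree :=
  tree_seq (map (@tree_arc _) (enum S)).

Definition ml_cap_steiner_tree (directed : bool) : opt_problem :=
  @OptProblem cst_instance (cst_legal directed) cst_candidate
    cst_feasible cst_cost tree_cst tree_cst_candidate.

(* Main.v *)
(* Attach to the graph a root r joined to the p sources, and p terminals per
   pair: i of those of pair i (i = 0, ..., p-1) hang on the source s_i and the
   other p - i on the sink s'_i.  With capacity p and p^2 terminals all p
   branches of a feasible tree are full.  Branch j has only j < p terminals on
   its own source, so it contains a sink, and by counting exactly one, say that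
   of pair i; then j + (p - i) = p gives i = j.  Hence the tree contains disjoint
   paths from s_i to s'_i.  New arcs have length 0.  Vertices that no source reaches
   lose their arcs and are hung on a source other than their own, which makes
   the new graph connected without making the instance feasible.

   For the complexity bounds, a Turing machine with four tapes used as stacks
   evaluates functions on trees: the tree on top of the main stack is replaced
   by its image.  The functions computed in polynomial time in this way are
   closed under composition, pairing, case distinction and folds whose
   accumulator grows by a polynomially bounded amount at each step. *)
From Corelib Require Import BinNums PosDef.
Require Import Defs.
From mathcomp Require Import all_boot all_order all_algebra.
From mathcomp Require Import zify.
Set Implicit Arguments.
Unset Strict Implicit.
Unset Printing Implicit Defensive.
Import Order.TTheory GRing.Theory Num.Theory.

(** * A language for four-stack machines *)

(** Reachability enters because the target problem demands a connected graph, or in the directed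
    case a root reaching every vertex, while the path problem demands nothing of the kind. An arc
    with an unreachable tail lies on no path from a source, so dropping it loses nothing; the danger
    lies in the new arcs that hang the unreachable vertices. Such an arc could be a shortcut to an
    unreachable sink, and in the undirected case the tree may also run through a new edge backwards.
    Since p >= 2, two sources are available, enough to hang every unreachable sink away from its own
    source; [old_path] shows that then no tree path from s_i to s'_i uses a new arc. The conversion
    reads a tree upwards from the sinks, because parents are unique and children are not. Lengths
    are only copied, never added or compared. Arithmetic is confined to unary vertex names and
    indices, and the one nonzero binary numeral to be computed is the capacity p. *)

Inductive reg := Main | Aux | Rev | Cnt.

Definition reg_eqb (r r' : reg) : bool :=
  match r, r' with
  | Main, Main | Aux, Aux | Rev, Rev | Cnt, Cnt => true
  | _, _ => false
  end.

Record store := St { main : word; aux : word; revd : word; cnt : word }.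

Definition get_reg (r : reg) (s : store) : word :=
  match r with Main => main s | Aux => aux s | Rev => revd s | Cnt => cnt s end.

Definition set_reg (r : reg) (w : word) (s : store) : store :=
  let: St m a v c := s in
  match r with
  | Main => St w a v c
  | Aux => St m w v c
  | Rev => St m a w c
  | Cnt => St m a v w
  end.

Lemma get_reg_set r r' w s :
  get_reg r' (set_reg r w s) = if reg_eqb r r' then w else get_reg r' s.
Proof. by case: s => m a v c; case: r; case: r'. Qed.

Inductive cmd :=
| Skip
| Push of reg & bool
| Pop of reg
| Seq of cmd & cmd
| If of reg & (option bool -> bool) & cmd & cmd
| While of reg & (option bool -> bool) & cmd.

(* [exec c s t s'] reads "[c] takes [s] to [s'] in at most [t] steps"; a push
   costs two steps because a machine step writes before it moves. *)
Inductive exec : cmd -> store -> nat -> store -> Prop :=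
| exec_skip s t : 0 < t -> exec Skip s t s
| exec_push r b s t : 1 < t -> exec (Push r b) s t (set_reg r (b :: get_reg r s) s)
| exec_pop r s t : 0 < t -> exec (Pop r) s t (set_reg r (behead (get_reg r s)) s)
| exec_seq c1 c2 s s1 s2 t1 t2 t :
    exec c1 s t1 s1 -> exec c2 s1 t2 s2 -> t1 + t2 <= t ->
    exec (Seq c1 c2) s t s2
| exec_if r P c1 c2 s s' t t' :
    exec (if P (ohead (get_reg r s)) then c1 else c2) s t s' -> t < t' ->
    exec (If r P c1 c2) s t' s'
| exec_while_stop r P c s t :
    P (ohead (get_reg r s)) = false -> 0 < t -> exec (While r P c) s t s
| exec_while_step r P c s s1 s2 t1 t2 t :
    P (ohead (get_reg r s)) = true -> exec c s t1 s1 -> exec (While r P c) s1 t2 s2 ->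
    t1 + t2 < t -> exec (While r P c) s t s2.

(** * Compilation of commands to machine instructions *)

Definition reg_ord (r : reg) : 'I_4 :=
  match r with
  | Main => ord0
  | Aux => @Ordinal 4 1 isT
  | Rev => @Ordinal 4 2 isT
  | Cnt => @Ordinal 4 3 isT
  end.

Lemma eq_reg_ord r r' : (reg_ord r' == reg_ord r) = reg_eqb r r'.
Proof. by case: r; case: r'. Qed.

Definition instr := {ffun 'I_4 -> cell} -> nat * {ffun 'I_4 -> cell * Defs.move}.

Definition keep (cs : {ffun 'I_4 -> cell}) : {ffun 'I_4 -> cell * Defs.move} :=
  [ffun i => (cs i, Stay)].

Definition act (r : reg) (f : cell -> cell) (m : Defs.move)
    (cs : {ffun 'I_4 -> cell}) : {ffun 'I_4 -> cell * Defs.move} :=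
  [ffun i => if i == reg_ord r then (f (cs i), m) else (cs i, Stay)].

Fixpoint csize (c : cmd) : nat :=
  match c with
  | Skip => 1
  | Push _ _ => 2
  | Pop _ => 1
  | Seq c1 c2 => csize c1 + csize c2
  | If _ _ c1 c2 => (csize c1 + csize c2).+1
  | While _ _ c => (csize c).+1
  end.

(* The code of [c] placed at address [s], which jumps to [e] when done. *)
Fixpoint compile (c : cmd) (s e : nat) : seq instr :=
  match c with
  | Skip => [:: fun cs => (e, keep cs)]
  | Push r b => [:: fun cs => (s.+1, act r id MoveL cs);
                    fun cs => (e, act r (fun=> Some b) Stay cs)]
  | Pop r => [:: fun cs => (e, act r (fun=> None) MoveR cs)]
  | Seq c1 c2 => compile c1 s (s + csize c1) ++ compile c2 (s + csize c1) e
  | If r P c1 c2 =>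
      (fun cs : {ffun _} => (if P (cs (reg_ord r)) then s.+1 else s.+1 + csize c1, keep cs))
      :: compile c1 s.+1 e ++ compile c2 (s.+1 + csize c1) e
  | While r P c =>
      (fun cs : {ffun _} => (if P (cs (reg_ord r)) then s.+1 else e, keep cs))
      :: compile c s.+1 s
  end.

Lemma size_compile c s e : size (compile c s e) = csize c.
Proof.
elim: c s e => [|r b|r|c1 IH1 c2 IH2|r P c1 IH1 c2 IH2|r P c IH] s e //=.
- by rewrite size_cat IH1 IH2.
- by rewrite size_cat IH1 IH2.
- by rewrite IH.
Qed.

(** The state is a program counter, and the address just past the last instruction is the halting
    one. The argument 3 gives four tapes, one per register. *)
Definition machine (prog : seq instr) : tm :=
  @TM 3 'I_(size prog).+1 ord0 (fun q => q == size prog :> nat)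
    (fun q cs => let a := nth (fun cs => (0, keep cs)) prog q cs in
                 (inord a.1, a.2)).

(** The top of the stack lies under the head and the stack grows to the left. The number of
    explicitly listed blanks is left open, since head moves create and consume them. *)
Definition tape_rep (t : tape) (w : word) : Prop :=
  (exists k, tape_left t = nseq k None) /\
  (exists k, tape_head t :: tape_right t = map Some w ++ nseq k None).

Definition rep (ts : {ffun 'I_4 -> tape}) (s : store) : Prop :=
  forall r, tape_rep (ts (reg_ord r)) (get_reg r s).

Lemma tape_rep_head t w : tape_rep t w -> tape_head t = ohead w.
Proof. by case=> _ [k]; case: w => [|b w] /=; [case: k => [|k]|] => // -[]. Qed.

Lemma rep_head ts s r : rep ts s -> tape_head (ts (reg_ord r)) = ohead (get_reg r s).
Proof. by move=> /(_ r) /tape_rep_head. Qed.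

Lemma shiftE t : shift Stay t = t.
Proof. by case: t. Qed.

Lemma shift_stay t : shift Stay (write (tape_head t) t) = t.
Proof. by case: t. Qed.

Lemma behead_nseq (T : Type) (x : T) k : behead (nseq k x) = nseq k.-1 x.
Proof. by case: k. Qed.

Lemma tape_rep_push t w b : tape_rep t w ->
  tape_rep (write (Some b) (shift MoveL (write (tape_head t) t))) (b :: w).
Proof.
case: t => l h r [[k /= ->] [k' /= E]]; split; first by exists k.-1; rewrite behead_nseq.
by exists k'; rewrite E.
Qed.

Lemma tape_rep_pop t w : tape_rep t w ->
  tape_rep (shift MoveR (write None t)) (behead w).
Proof.
case: t => l h r [[k /= ->] [k' /= E]]; split; first by exists k.+1.
case: w E => [|b w] /= E.
  case: k' E => // k' [_ ->]; case: k' => [|k'] /=; first by exists 1.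
  by exists k'.+1.
case: E => _ ->; case: w => [|b' w] /=; last by exists k'.
by case: k' => [|k']; [exists 1|exists k'.+1].
Qed.

Local Arguments shift : simpl never.
Local Arguments tm_step : simpl never.
Local Arguments write : simpl never.

(** * Simulation of commands by the machine *)

Section Simulation.

Variable prog : seq instr.
Let M := machine prog.

Definition config (q : nat) (ts : {ffun 'I_4 -> tape}) : tm_config M :=
  (inord q, ts).

Lemma machine_step pre i post (ts : {ffun 'I_4 -> tape}) : prog = pre ++ i :: post ->
  let a := i [ffun j => tape_head (ts j)] in
  tm_step (config (size pre) ts) =
  config a.1 ([ffun j => shift (a.2 j).2 (write (a.2 j).1 (ts j))]).
Proof.
move=> E; have Ei x0 : nth x0 prog (size pre) = i by rewrite E nth_cat ltnn subnn.
rewrite /tm_step /= inordK; last by rewrite E size_cat /= ltnS leq_addr.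
rewrite ifN; last by rewrite E size_cat /= neq_ltn -[X in X < _]addn0 ltn_add2l.
by rewrite Ei.
Qed.

Lemma apply_keep (ts : {ffun 'I_4 -> tape}) :
  let a := keep [ffun j => tape_head (ts j)] in
  [ffun j => shift (a j).2 (write (a j).1 (ts j))] = ts.
Proof. by apply/ffunP=> j; rewrite !ffunE; exact: shift_stay. Qed.

Lemma rep_act (ts : {ffun 'I_4 -> tape}) s r f m w : rep ts s ->
  tape_rep (shift m (write (f (tape_head (ts (reg_ord r)))) (ts (reg_ord r)))) w ->
  let a := act r f m [ffun j => tape_head (ts j)] in
  rep [ffun j => shift (a j).2 (write (a j).1 (ts j))] (set_reg r w s).
Proof.
move=> rep_s rep_w /= r'; rewrite get_reg_set !ffunE eq_reg_ord.
case: ifP => [|_]; last by rewrite /= shift_stay.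
by move: rep_w; case: r; case: r'.
Qed.

(** The induction is on the execution, not on the command, so that a loop can use the hypothesis for
    its remaining rounds. The code may sit anywhere between [pre] and [post] and may exit to any
    address [e]; a loop body exits to the address of the loop test. *)
Lemma simulation c s t s' : exec c s t s' -> forall pre post e ts,
  prog = pre ++ compile c (size pre) e ++ post -> e <= size prog -> rep ts s ->
  exists k ts', [/\ k <= t, rep ts' s' &
    iter k (@tm_step M) (config (size pre) ts) = config e ts'].
Proof.
elim=> {c s t s'}.
- move=> s t t_gt0 pre post e ts E _ rep_s; exists 1, ts; split=> //=.
  by rewrite (machine_step ts E) /= apply_keep.
- move=> r b s t t_gt1 pre post e ts E _ rep_s.
  set ts1 := [ffun j => shift (act r id MoveL [ffun j => tape_head (ts j)] j).2
    (write (act r id MoveL [ffun j => tape_head (ts j)] j).1 (ts j))].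
  set ts2 := [ffun j => shift (act r (fun=> Some b) Stay [ffun j => tape_head (ts1 j)] j).2
    (write (act r (fun=> Some b) Stay [ffun j => tape_head (ts1 j)] j).1 (ts1 j))].
  exists 2, ts2; split=> //.
    move=> r'; rewrite get_reg_set !ffunE eq_reg_ord; case: ifP => rr' /=; last first.
      by rewrite !rr' /= !shift_stay; apply: rep_s.
    have -> : reg_ord r' = reg_ord r by apply/eqP; rewrite eq_reg_ord rr'.
    by rewrite shiftE; apply: tape_rep_push.
  rewrite /= (machine_step ts E) /=.
  have E' : prog = rcons pre (fun cs => ((size pre).+1, act r id MoveL cs))
      ++ (fun cs => (e, act r (fun=> Some b) Stay cs)) :: post.
    by rewrite E cat_rcons.
  by move: (machine_step ts1 E'); rewrite size_rcons /= => ->.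
- move=> r s t t_gt0 pre post e ts E _ rep_s.
  eexists 1, _; split=> //=; last by rewrite (machine_step ts E).
  by apply: rep_act => //; apply: tape_rep_pop.
- move=> c1 c2 s s1 s2 t1 t2 t _ IH1 _ IH2 le_t pre post e ts E le_e rep_s.
  have sz := size_compile; rewrite /= -catA in E.
  have [||k1 [ts1 [le_k1 rep1 E1]]] := IH1 _ _ _ ts E => //.
    by rewrite E !size_cat sz leq_add2l leq_addr.
  have E' : prog = (pre ++ compile c1 (size pre) (size pre + csize c1)) ++
      compile c2 (size (pre ++ compile c1 (size pre) (size pre + csize c1))) e ++ post.
    by rewrite E -catA size_cat sz.
  have [k2 [ts2 [le_k2 rep2 E2]]] := IH2 _ _ _ _ E' le_e rep1.
  exists (k2 + k1), ts2; split=> //; first by lia.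
  by rewrite iterD E1 -E2 size_cat sz.
- move=> r P c1 c2 s s' t t' _ IH lt_t pre post e ts E le_e rep_s.
  have sz := size_compile; rewrite /= in E.
  set i0 := (X in X :: _) in E.
  have [k [ts' [le_k rep' Ek]]] : exists k ts', [/\ k <= t, rep ts' s' &
      iter k (@tm_step M) (config (if P (ohead (get_reg r s)) then (size pre).+1
                        else (size pre).+1 + csize c1) ts) = config e ts'].
    case: ifP IH => _ IH.
    - rewrite -(size_rcons pre i0); apply: (IH _ (compile c2 ((size pre).+1 + csize c1) e ++ post)) => //.
      by rewrite E cat_rcons size_rcons /= catA.
    - have -> : (size pre).+1 + csize c1 = size (rcons pre i0 ++ compile c1 (size pre).+1 e).
        by rewrite size_cat size_rcons sz.
      apply: (IH _ post) => //.
      by rewrite size_cat sz size_rcons E -catA cat_rcons /= -!catA.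
  exists k.+1, ts'; split=> //; first by lia.
  by rewrite iterSr (machine_step ts E) /i0 /= apply_keep ffunE (rep_head _ rep_s).
- move=> r P c s t notP t_gt0 pre post e ts E _ rep_s; exists 1, ts; split=> //=.
  by rewrite (machine_step ts E) /= apply_keep ffunE (rep_head _ rep_s) notP.
- move=> r P c s s1 s2 t1 t2 t isP _ IH1 _ IH2 lt_t pre post e ts E le_e rep_s.
  have E0 := E; rewrite /= in E; set i0 := (X in X :: _) in E.
  have [|||k1 [ts1 [le_k1 rep1 E1]]] := IH1 (rcons pre i0) post (size pre) ts => //.
  - by rewrite size_rcons cat_rcons.
  - by rewrite E size_cat leq_addr.
  have [k2 [ts2 [le_k2 rep2 E2]]] := IH2 _ _ _ _ E0 le_e rep1.
  exists (k2 + k1.+1), ts2; split=> //; first by lia.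
  rewrite iterD iterSr (machine_step ts E) {1 2}/i0 /= apply_keep ffunE (rep_head _ rep_s) isP.
  by rewrite size_rcons in E1; rewrite E1 -E2.
Qed.

Lemma tm_step_halted (c : tm_config M) k : tm_halt c.1 -> iter k (@tm_step M) c = c.
Proof.
move=> halt_c; elim: k => //= k ->; case: c halt_c => q ts /= halt_q.
by rewrite /tm_step /= halt_q.
Qed.

End Simulation.

Lemma word_tape_rep w : tape_rep (word_tape w) w.
Proof.
split; first by exists 0.
by case: w => [|b w]; [exists 1|exists 0; rewrite cats0].
Qed.

Lemma tape_rep_output t w : tape_rep t w ->
  bits_before_blank (tape_head t :: tape_right t) = w.
Proof. by case=> _ [k ->]; elim: w => [|b w /= ->] //; case: k. Qed.

(** The simulation may halt before the polynomial bound is reached; the surplus steps are idle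
    because a halted configuration steps to itself. *)
Lemma exec_poly_time (X : Type) (D : X -> Prop) (inp out : X -> word) (c : cmd)
    (k : nat) (s : word -> store) :
  (forall x, D x -> exec c (St (inp x) [::] [::] [::]) ((size (inp x)).+2 ^ k)
                      (s (out x))) ->
  (forall w, main (s w) = w) ->
  poly_time D inp out.
Proof.
move=> exec_c main_s; pose prog := compile c 0 (csize c).
have sz_prog : size prog = csize c by rewrite size_compile.
exists (machine prog), (('X + 2%:P) ^+ k)%R => x Dx.
have rep0 : rep (tm_init (machine prog) (inp x)).2 (St (inp x) [::] [::] [::]).
  by case; rewrite ffunE /=; apply: word_tape_rep.
have [||j [ts [le_j rep_ts Ej]]] :=
  simulation (exec_c x Dx) (prog := prog) (pre := [::]) (post := [::])
    (e := csize c) _ _ rep0.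
- by rewrite cats0.
- by rewrite sz_prog.
have E : tm_init (machine prog) (inp x) =
    config prog 0 (tm_init (machine prog) (inp x)).2.
  by congr (_, _); apply/val_inj; rewrite /= inordK.
have q_eq : horner (('X + 2%:P) ^+ k)%R (size (inp x)) = (size (inp x)).+2 ^ k.
  by rewrite horner_exp hornerD hornerX hornerC -[in RHS]addn2 -natrXE.
have halted : tm_halt (iter j (@tm_step (machine prog)) (tm_init (machine prog) (inp x))).1.
  by rewrite E Ej /= inordK sz_prog.
rewrite /tm_computes_within q_eq -(subnK le_j) iterD (tm_step_halted _ halted).
split=> //; rewrite /tm_output E Ej /= -[RHS](main_s (out x)).
by apply: tape_rep_output; apply: (rep_ts Main).
Qed.

(** * Polynomially bounded functions *)

(** The base n + 2 is at least 2 even for n = 0, so a single exponent absorbs constants, sums and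
    products. *)
Definition poly_bounded (f : nat -> nat) : Prop :=
  exists k, forall n, f n <= n.+2 ^ k.

Lemma poly_bounded_const c : poly_bounded (fun=> c).
Proof.
exists c => n; apply: leq_trans (ltnW (ltn_expl c (ltnSn 1))) _.
by case: c => // c; rewrite leq_exp2r.
Qed.

Lemma poly_bounded_id : poly_bounded id.
Proof. by exists 1 => n; rewrite expn1; lia. Qed.

Lemma poly_bounded_add f g :
  poly_bounded f -> poly_bounded g -> poly_bounded (fun n => f n + g n).
Proof.
move=> [k Hf] [l Hg]; exists (maxn k l).+1 => n.
have Hk : n.+2 ^ k <= n.+2 ^ maxn k l by rewrite leq_exp2l // leq_maxl.
have Hl : n.+2 ^ l <= n.+2 ^ maxn k l by rewrite leq_exp2l // leq_maxr.
have := Hf n; have := Hg n; rewrite expnS; nia.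
Qed.

Lemma poly_bounded_mul f g :
  poly_bounded f -> poly_bounded g -> poly_bounded (fun n => f n * g n).
Proof. by move=> [k Hf] [l Hg]; exists (k + l) => n; rewrite expnD leq_mul. Qed.

Lemma poly_bounded_S f : poly_bounded f -> poly_bounded (fun n => (f n).+1).
Proof.
move=> Hf; have [k H] := poly_bounded_add Hf (poly_bounded_const 1).
by exists k => n; rewrite -addn1.
Qed.

Lemma poly_bounded_exp f k :
  poly_bounded f -> poly_bounded (fun n => f n ^ k).
Proof.
move=> Hf; elim: k => [|k IH].
  by have [l H] := poly_bounded_const 1; exists l => n; rewrite expn0.
by have [l H] := poly_bounded_mul Hf IH; exists l => n; rewrite expnS.
Qed.

Ltac poly_bound := repeat first
  [ exact: poly_bounded_id | exact: poly_bounded_const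
  | apply: poly_bounded_S | apply: poly_bounded_add | apply: poly_bounded_mul
  | apply: poly_bounded_exp | assumption ].

Lemma leq_pow k m n : m <= n -> m.+2 ^ k <= n.+2 ^ k.
Proof. by move=> le_mn; case: k => // k; rewrite leq_exp2r. Qed.

(** * Moving prefix codes between stacks *)

Definition code_size (t : tree) : nat := size (code t).

Lemma code_size_node l r : code_size (Node l r) = (code_size l + code_size r).+1.
Proof. by rewrite /code_size /= size_cat. Qed.

Lemma code_size_gt0 t : 0 < code_size t.
Proof. by case: t. Qed.

Definition sel (b : bool) : reg := if b then Main else Aux.

Definition st_sel (b : bool) (x y v c : word) : store :=
  if b then St x y v c else St y x v c.

Definition top_is (b : bool) (o : option bool) : bool := o == Some b.

(** Reading a node symbol turns one pending tree into two, reading a leaf symbol settles one. Hence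
    the counter runs empty exactly at the end of the prefix code, with no delimiter needed. *)
Definition parse_loop (b : bool) : cmd :=
  While Cnt isSome
    (If (sel b) (top_is true)
      (Seq (Pop (sel b)) (Seq (Push Rev true) (Push Cnt true)))
      (Seq (Pop (sel b)) (Seq (Push Rev false) (Pop Cnt)))).

Lemma exec_le c s t t' s' : exec c s t s' -> t <= t' -> exec c s t' s'.
Proof.
move=> H; case: H => {c s t s'}.
- by move=> s t ? ?; apply: exec_skip; lia.
- by move=> r b s t ? ?; apply: exec_push; lia.
- by move=> r s t ? ?; apply: exec_pop; lia.
- by move=> c1 c2 s s1 s2 t1 t2 t H1 H2 ? ?; apply: exec_seq H1 H2 _; lia.
- by move=> r P c1 c2 s s' t1 t H1 ? ?; apply: exec_if H1 _; lia.
- by move=> r P c s t H1 ? ?; apply: exec_while_stop => //; lia.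
- by move=> r P c s s1 s2 t1 t2 t H1 H2 H3 ? ?; apply: exec_while_step H1 H2 H3 _; lia.
Qed.

Lemma exec_seq_eq c1 c2 s s1 s2 t1 t2 :
  exec c1 s t1 s1 -> exec c2 s1 t2 s2 -> exec (Seq c1 c2) s (t1 + t2) s2.
Proof. by move=> H1 H2; apply: exec_seq H1 H2 _. Qed.

Lemma exec_push_eq r b s s' : s' = set_reg r (b :: get_reg r s) s ->
  exec (Push r b) s 2 s'.
Proof. by move=> ->; apply: exec_push. Qed.

Lemma exec_pop_eq r s s' : s' = set_reg r (behead (get_reg r s)) s ->
  exec (Pop r) s 1 s'.
Proof. by move=> ->; apply: exec_pop. Qed.

(* The counter holds in unary the number of trees still to be read. *)
Lemma exec_parse_loop b t x y v k T s' :
  exec (parse_loop b) (st_sel b x y (catrev (code t) v) (nseq k true)) T s' ->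
  exec (parse_loop b) (st_sel b (code t ++ x) y v (nseq k.+1 true))
       (7 * code_size t + T) s'.
Proof.
elim: t x v k T s' => [|l IHl r IHr] x v k T s' H.
  apply: (@exec_while_step _ _ _ _ (st_sel b x y (false :: v) (nseq k true)) _ 5 T);
    [by destruct b | | exact: H | by rewrite /code_size /=; lia].
  apply: (@exec_if _ _ _ _ _ _ 4); last by [].
  rewrite ifF; last by destruct b.
  apply: (@exec_seq_eq _ _ _ (st_sel b x y v (nseq k.+1 true)) _ 1 3).
    by apply: exec_pop_eq; destruct b.
  apply: (@exec_seq_eq _ _ _ (st_sel b x y (false :: v) (nseq k.+1 true)) _ 2 1).
    by apply: exec_push_eq; destruct b.
  by apply: exec_pop_eq; destruct b.
(* The run is assembled from its end: the right subtree is put in front of the given continuation,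
   then the left subtree in front of that. *)
have Hr : exec (parse_loop b)
    (st_sel b (code r ++ x) y (catrev (code l) (true :: v)) (nseq k.+1 true))
    (7 * code_size r + T) s'.
  by apply: IHr; move: H; rewrite /= catrev_catl.
move: (IHl _ _ _ _ _ Hr); set T1 := (T in exec _ _ T _) => Hl.
apply: (@exec_while_step _ _ _ _ (st_sel b (code l ++ code r ++ x) y (true :: v)
  (nseq k.+2 true)) _ 6 T1); [by destruct b | | exact: Hl |
  by rewrite /T1 code_size_node; lia].
apply: (@exec_if _ _ _ _ _ _ 5); last by [].
rewrite ifT; last by destruct b.
apply: (@exec_seq_eq _ _ _ (st_sel b (code l ++ code r ++ x) y v (nseq k.+1 true)) _ 1 4).
  by apply: exec_pop_eq; destruct b; rewrite /= catA.
apply: (@exec_seq_eq _ _ _ (st_sel b (code l ++ code r ++ x) y (true :: v) (nseq k.+1 true)) _ 2 2).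
  by apply: exec_push_eq; destruct b.
by apply: exec_push_eq; destruct b.
Qed.

Definition push_if (c : bool) (r : reg) (b : bool) : cmd :=
  if c then Push r b else Skip.

Lemma exec_push_if c r b s :
  exec (push_if c r b) s 2 (if c then set_reg r (b :: get_reg r s) s else s).
Proof. by case: c; [apply: exec_push|apply: exec_skip]. Qed.

(** Parsing leaves the code reversed on [Rev]; popping it restores the order. Having both targets
    selectable lets one command move, copy or discard a tree. *)
Definition unload (bm ba : bool) : cmd :=
  While Rev isSome
    (If Rev (top_is true)
      (Seq (Pop Rev) (Seq (push_if bm Main true) (push_if ba Aux true)))
      (Seq (Pop Rev) (Seq (push_if bm Main false) (push_if ba Aux false)))).

Lemma exec_unload bm ba m a v c :
  exec (unload bm ba) (St m a v c) (7 * size v).+1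
    (St (if bm then catrev v m else m) (if ba then catrev v a else a) [::] c).
Proof.
elim: v m a => [|b v IH] m a; first by destruct bm, ba; apply: exec_while_stop.
apply: (@exec_while_step _ _ _ _ (St (if bm then b :: m else m)
   (if ba then b :: a else a) v c) _ 6 (7 * size v).+1) => //=; last by lia.
  apply: (@exec_if _ _ _ _ _ _ 5); last by [].
  have -> : (if top_is true (ohead (b :: v))
    then Seq (Pop Rev) (Seq (push_if bm Main true) (push_if ba Aux true))
    else Seq (Pop Rev) (Seq (push_if bm Main false) (push_if ba Aux false))) =
    Seq (Pop Rev) (Seq (push_if bm Main b) (push_if ba Aux b)) by case: b.
  apply: (@exec_seq_eq _ _ _ (St m a v c) _ 1 4); first exact: exec_pop_eq.
  apply: (@exec_seq_eq _ _ _ (St (if bm then b :: m else m) a v c) _ 2 2).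
    by have := exec_push_if bm Main b (St m a v c); destruct bm.
  by have := exec_push_if ba Aux b (St (if bm then b :: m else m) a v c); destruct ba.
by have := IH (if bm then b :: m else m) (if ba then b :: a else a); destruct bm, ba.
Qed.

(* Moves the top tree of [sel b] to [Main] if [bm] and to [Aux] if [ba]. *)
Definition transfer (b bm ba : bool) : cmd :=
  Seq (Push Cnt true) (Seq (parse_loop b) (unload bm ba)).

Lemma catrev_catrevK (T : Type) (s u : seq T) : catrev (catrev s [::]) u = s ++ u.
Proof. by rewrite !catrevE cats0 revK. Qed.

Lemma exec_transfer b bm ba t x y :
  exec (transfer b bm ba) (st_sel b (code t ++ x) y [::] [::]) (18 * code_size t)
    (let m := if b then x else y in let a := if b then y else x in
     St (if bm then code t ++ m else m) (if ba then code t ++ a else a) [::] [::]).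
Proof.
have t_gt0 := code_size_gt0 t; set s' := (s' in exec _ _ _ s').
have H1 : exec (Push Cnt true) (st_sel b (code t ++ x) y [::] [::]) 2
    (st_sel b (code t ++ x) y [::] (nseq 1 true)) by apply: exec_push_eq; destruct b.
have H2 : exec (parse_loop b) (st_sel b (code t ++ x) y [::] (nseq 1 true))
    (7 * code_size t + 1) (st_sel b x y (catrev (code t) [::]) (nseq 0 true)).
  by apply: exec_parse_loop; apply: exec_while_stop; destruct b.
have H3 : exec (unload bm ba) (st_sel b x y (catrev (code t) [::]) (nseq 0 true))
    (7 * code_size t).+1 s'.
  have -> : st_sel b x y (catrev (code t) [::]) (nseq 0 true) =
    St (if b then x else y) (if b then y else x) (catrev (code t) [::]) [::].
    by destruct b.
  have := exec_unload bm ba (if b then x else y) (if b then y else x)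
    (catrev (code t) [::]) [::].
  by rewrite !catrev_catrevK catrevE cats0 size_rev.
by apply: exec_le (exec_seq_eq H1 (exec_seq_eq H2 H3)) _; lia.
Qed.

(** * Functions on trees computed in polynomial time *)

(** Quantifying over what lies beneath on both stacks makes the programs composable. The output size
    is bounded as well, because the running time of the next program is measured in it. *)
Definition poly_fun (F : tree -> tree) : Prop :=
  exists c k, forall t, code_size (F t) <= (code_size t).+2 ^ k /\
    forall m a, exec c (St (code t ++ m) a [::] [::]) ((code_size t).+2 ^ k)
                  (St (code (F t) ++ m) a [::] [::]).

Lemma poly_fun_intro F c f g : poly_bounded f -> poly_bounded g ->
  (forall t, code_size (F t) <= f (code_size t)) ->
  (forall t m a, exec c (St (code t ++ m) a [::] [::]) (g (code_size t))
                   (St (code (F t) ++ m) a [::] [::])) ->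
  poly_fun F.
Proof.
move=> Hf Hg size_F exec_F.
have [k Hk] := poly_bounded_add Hf Hg; exists c, k => t; have := Hk (code_size t).
split; first by apply: leq_trans (size_F t) _; lia.
by move=> m a; apply: exec_le (exec_F t m a) _; lia.
Qed.

Lemma poly_fun_ext F G : F =1 G -> poly_fun F -> poly_fun G.
Proof. by move=> E [c [k H]]; exists c, k => t; rewrite -E. Qed.

Lemma poly_time_poly_fun (X : Type) (D : X -> Prop) (inp out : X -> tree) F :
  poly_fun F -> (forall x, D x -> F (inp x) = out x) ->
  poly_time D (fun x => code (inp x)) (fun x => code (out x)).
Proof.
move=> [c [k H]] E.
apply: (@exec_poly_time _ _ _ _ c k (fun w => St w [::] [::] [::])) => // x Dx.
by have [_ /(_ [::] [::])] := H (inp x); rewrite !cats0 E.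
Qed.

Lemma poly_fun_id : poly_fun id.
Proof.
apply: (@poly_fun_intro _ Skip id (fun=> 1)); [poly_bound | poly_bound | by [] |].
by move=> t m a; apply: exec_skip.
Qed.

Lemma poly_fun_comp F G : poly_fun F -> poly_fun G -> poly_fun (fun t => F (G t)).
Proof.
move=> [cF [kF HF]] [cG [kG HG]].
apply: (@poly_fun_intro _ (Seq cG cF) (fun n => (n.+2 ^ kG).+2 ^ kF)
  (fun n => n.+2 ^ kG + (n.+2 ^ kG).+2 ^ kF)).
- by poly_bound.
- by poly_bound.
- by move=> t; apply: leq_trans (proj1 (HF _)) (leq_pow _ (proj1 (HG t))).
move=> t m a; apply: exec_seq_eq (proj2 (HG t) m a) _.
by apply: exec_le (proj2 (HF _) m a) (leq_pow _ (proj1 (HG t))).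
Qed.

Definition drop_top : cmd := transfer true false false.

Lemma exec_drop_top t m a :
  exec drop_top (St (code t ++ m) a [::] [::]) (18 * code_size t) (St m a [::] [::]).
Proof. exact: (exec_transfer true false false). Qed.

Lemma exec_main_aux t m a :
  exec (transfer true false true) (St (code t ++ m) a [::] [::]) (18 * code_size t)
    (St m (code t ++ a) [::] [::]).
Proof. exact: (exec_transfer true false true). Qed.

Lemma exec_aux_main t m a :
  exec (transfer false true false) (St m (code t ++ a) [::] [::]) (18 * code_size t)
    (St (code t ++ m) a [::] [::]).
Proof. exact: (exec_transfer false true false). Qed.

Definition dup : cmd := Seq (transfer true true true) (transfer false true false).

Lemma exec_dup t m a :
  exec dup (St (code t ++ m) a [::] [::]) (36 * code_size t)
    (St (code t ++ code t ++ m) a [::] [::]).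
Proof.
apply: exec_le (exec_seq_eq (exec_transfer true true true t m a) (exec_aux_main _ _ _)) _.
by lia.
Qed.

(** The input is duplicated, and the value of [F] is parked on [Aux] while [G] consumes the second
    copy. *)
Lemma poly_fun_node F G :
  poly_fun F -> poly_fun G -> poly_fun (fun t => Node (F t) (G t)).
Proof.
move=> [cF [kF HF]] [cG [kG HG]].
apply: (@poly_fun_intro _
  (Seq dup (Seq cF (Seq (transfer true false true)
    (Seq cG (Seq (transfer false true false) (Push Main true))))))
  (fun n => (n.+2 ^ kF + n.+2 ^ kG).+1)
  (fun n => 36 * n + (n.+2 ^ kF + (18 * n.+2 ^ kF + (n.+2 ^ kG + (18 * n.+2 ^ kF + 2)))))).
- by poly_bound.
- by poly_bound.
- by move=> t; rewrite code_size_node ltnS leq_add // ?(proj1 (HF t)) ?(proj1 (HG t)).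
move=> t m a; have [sF eF] := HF t; have [sG eG] := HG t.
apply: exec_seq_eq (exec_dup t m a) _; apply: exec_seq_eq (eF _ _) _.
apply: exec_seq_eq; first by apply: exec_le (exec_main_aux _ _ _) _; lia.
apply: exec_seq_eq (eG _ _) _.
apply: exec_seq_eq; first by apply: exec_le (exec_aux_main _ _ _) _; lia.
by apply: exec_push_eq; rewrite /= catA.
Qed.

Fixpoint push_word (w : word) : cmd :=
  if w is b :: w' then Seq (push_word w') (Push Main b) else Skip.

Lemma exec_push_word w m a :
  exec (push_word w) (St m a [::] [::]) (2 * size w).+1 (St (w ++ m) a [::] [::]).
Proof.
elim: w => [|b w IH] /=; first exact: exec_skip.
by apply: exec_le (exec_seq_eq IH (exec_push_eq _)) _ => //; lia.
Qed.

Lemma poly_fun_const u : poly_fun (fun=> u).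
Proof.
apply: (@poly_fun_intro _ (Seq drop_top (push_word (code u)))
  (fun=> code_size u) (fun n => 18 * n + (2 * code_size u).+1)).
- by poly_bound.
- by poly_bound.
- by [].
by move=> t m a; apply: exec_seq_eq (exec_drop_top _ _ _) (exec_push_word _ _ _).
Qed.

Definition tfst (t : tree) : tree := if t is Node l _ then l else Leaf.
Definition tsnd (t : tree) : tree := if t is Node _ r then r else Leaf.
Definition is_node (t : tree) : bool := if t is Node _ _ then true else false.

Lemma code_size_tfst t : code_size (tfst t) <= code_size t.
Proof. by case: t => // l r; rewrite code_size_node /=; lia. Qed.

Lemma code_size_tsnd t : code_size (tsnd t) <= code_size t.
Proof. by case: t => // l r; rewrite code_size_node /=; lia. Qed.

Lemma top_code t m : top_is true (ohead (code t ++ m)) = is_node t.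
Proof. by case: t. Qed.

Lemma poly_fun_tfst F : poly_fun F -> poly_fun (fun t => tfst (F t)).
Proof.
apply: (@poly_fun_comp tfst).
apply: (@poly_fun_intro _
  (If Main (top_is true) (Seq (Pop Main) (Seq (transfer true false true)
     (Seq drop_top (transfer false true false)))) Skip) id (fun n => 54 * n + 2)).
- by poly_bound.
- by poly_bound.
- exact: code_size_tfst.
move=> t m a; apply: (@exec_if _ _ _ _ _ _ (54 * code_size t + 1)); last by lia.
rewrite /= top_code; case: t => [|l r] /=; first by apply: exec_skip; lia.
apply: exec_le (exec_seq_eq (exec_pop_eq (s' := St (code l ++ code r ++ m) a [::] [::]) _)
  (exec_seq_eq (exec_main_aux _ _ _)
  (exec_seq_eq (exec_drop_top _ _ _) (exec_aux_main _ _ _)))) _; first by rewrite /= catA.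
by rewrite code_size_node; lia.
Qed.

Lemma poly_fun_tsnd F : poly_fun F -> poly_fun (fun t => tsnd (F t)).
Proof.
apply: (@poly_fun_comp tsnd).
apply: (@poly_fun_intro _
  (If Main (top_is true) (Seq (Pop Main) drop_top) Skip) id (fun n => 18 * n + 3)).
- by poly_bound.
- by poly_bound.
- exact: code_size_tsnd.
move=> t m a; apply: (@exec_if _ _ _ _ _ _ (18 * code_size t + 2)); last by lia.
rewrite /= top_code; case: t => [|l r] /=; first by apply: exec_skip; lia.
apply: exec_le (exec_seq_eq (exec_pop_eq (s' := St (code l ++ code r ++ m) a [::] [::]) _)
  (exec_drop_top _ _ _)) _; first by rewrite /= catA.
by rewrite code_size_node; lia.
Qed.

Lemma poly_fun_if C F G : poly_fun C -> poly_fun F -> poly_fun G ->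
  poly_fun (fun t => if is_node (C t) then F t else G t).
Proof.
move=> [cC [kC HC]] [cF [kF HF]] [cG [kG HG]].
apply: (@poly_fun_intro _
  (Seq dup (Seq cC (If Main (top_is true) (Seq drop_top cF) (Seq drop_top cG))))
  (fun n => n.+2 ^ kF + n.+2 ^ kG)
  (fun n => 36 * n + (n.+2 ^ kC + (18 * n.+2 ^ kC + (n.+2 ^ kF + n.+2 ^ kG)).+1))).
- by poly_bound.
- by poly_bound.
- move=> t; have [sF _] := HF t; have [sG _] := HG t.
  by case: ifP => _; lia.
move=> t m a; have [sC eC] := HC t; have [sF eF] := HF t; have [sG eG] := HG t.
apply: exec_seq_eq (exec_dup t m a) _; apply: exec_seq_eq (eC _ _) _.
apply: exec_if (ltnSn _); rewrite top_code.
by case: ifP => _; (apply: exec_seq; first exact: exec_drop_top); eauto; lia.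
Qed.

(** * Loops *)

(** Every tree is a list of trees along its right spine. So lists, unary numbers (only the length
    counts) and truth values (empty or not) are all plain trees, and every function is total. *)
Fixpoint items (t : tree) : seq tree :=
  if t is Node x t' then x :: items t' else [::].

Lemma tree_seqK : cancel tree_seq items.
Proof. by elim=> //= x s ->. Qed.

Lemma itemsK : cancel items tree_seq.
Proof. by elim=> //= x _ t ->. Qed.

Lemma size_items t : size (items t) < code_size t.
Proof. by elim: t => //= x _ t IH; rewrite code_size_node; lia. Qed.

Fixpoint all_small (n : nat) (s : seq tree) : Prop :=
  if s is x :: s' then code_size x <= n /\ all_small n s' else True.

Lemma all_small_items t n : code_size t <= n -> all_small n (items t).
Proof. by elim: t => //= x _ t IH; rewrite code_size_node => le_n; split; [|apply: IH]; lia. Qed.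

Section Fold.

Variables (S : tree -> tree) (cS : cmd) (kS : nat).
Hypothesis HS : forall t, forall m a,
  exec cS (St (code t ++ m) a [::] [::]) ((code_size t).+2 ^ kS)
    (St (code (S t) ++ m) a [::] [::]).

Definition step (acc x : tree) : tree := S (Node x acc).

Definition fold_loop : cmd :=
  While Aux (top_is true)
    (Seq (Pop Aux) (Seq (transfer false true false) (Seq (Push Main true) cS))).

Lemma exec_fold_loop s acc m a X B :
  all_small X s -> (forall j, code_size (foldl step acc (take j s)) <= B) ->
  exec fold_loop (St (code acc ++ m) (code (tree_seq s) ++ a) [::] [::])
    (size s * (18 * X + (X + B).+3 ^ kS + 5)).+1
    (St (code (foldl step acc s) ++ m) (false :: a) [::] [::]).
Proof.
elim: s acc => [|x s IH] acc /=; first by move=> _ _; apply: exec_while_stop.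
move=> [le_x small_s] le_B; have le_acc := le_B 0; rewrite /= in le_acc.
have /(IH (step acc x) small_s) H : forall j, code_size (foldl step (step acc x) (take j s)) <= B.
  by move=> j; apply: (le_B j.+1).
apply: (exec_while_step (s1 := St (code (step acc x) ++ m) (code (tree_seq s) ++ a) [::] [::])
  (t1 := 18 * X + (X + B).+3 ^ kS + 4) _ _ H) => //; last by lia.
apply: exec_le (exec_seq_eq (exec_pop_eq
   (s' := St (code acc ++ m) (code x ++ code (tree_seq s) ++ a) [::] [::]) _)
  (exec_seq_eq (exec_aux_main _ _ _) (exec_seq_eq (exec_push_eq
    (s' := St (code (Node x acc) ++ m) (code (tree_seq s) ++ a) [::] [::]) _) (HS _ _ _)))) _.
- by rewrite /= catA.
- by rewrite /= catA.
have : (code_size (Node x acc)).+2 ^ kS <= (X + B).+3 ^ kS.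
  by apply: leq_pow; rewrite code_size_node; lia.
by lia.
Qed.

End Fold.

(** A polynomial time step repeated polynomially often can still blow up, as repeated squaring does;
    hence the bound on all intermediate accumulators. *)
Lemma poly_fun_fold_aux S L A k : poly_fun S -> poly_fun L -> poly_fun A ->
  (forall e j, code_size (foldl (step S) (A e) (take j (items (L e)))) <= (code_size e).+2 ^ k) ->
  poly_fun (fun e => foldl (step S) (A e) (items (L e))).
Proof.
move=> [cS [kS HS]] PL PA bound.
have [cN [kN HN]] := poly_fun_node PL PA; have [cL [kL HL]] := PL.
apply: (@poly_fun_intro _ (Seq cN (Seq (Pop Main) (Seq (transfer true false true)
    (Seq (fold_loop cS) (Pop Aux)))))
  (fun n => n.+2 ^ k)
  (fun n => n.+2 ^ kN + (1 + (18 * n.+2 ^ kL +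
     ((n.+2 ^ kL * (18 * n.+2 ^ kL + ((n.+2 ^ kL + n.+2 ^ k).+1).+2 ^ kS + 5)).+1 + 1))))).
- by poly_bound.
- by poly_bound.
- move=> t; have := bound t (size (items (L t))); by rewrite take_size.
move=> t m a; have [sL _] := HL t; have [_ eN] := HN t.
apply: exec_seq_eq (eN _ _) _.
apply: (exec_seq_eq (s1 := St (code (L t) ++ code (A t) ++ m) a [::] [::])).
  by apply: exec_pop_eq; rewrite /= catA.
apply: exec_seq_eq; first by apply: exec_le (exec_main_aux _ _ _) _; lia.
apply: (exec_seq_eq (s1 := St (code (foldl (step S) (A t) (items (L t))) ++ m)
  (false :: a) [::] [::])); last exact: exec_pop_eq.
have := exec_fold_loop (fun t => proj2 (HS t)) m a (all_small_items sL) (bound t).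
rewrite itemsK => H; apply: exec_le H _.
by rewrite ltnS leq_mul2r; have := size_items (L t); lia.
Qed.

(** The loop program sees only the list entry and the accumulator, so the environment [e] travels
    inside the accumulator. As each step adds at most [b (code_size e)], whatever the accumulator,
    all intermediate results stay polynomial in [e]. *)
Lemma poly_fun_foldl (f : tree -> tree -> tree -> tree) L A :
  poly_fun L -> poly_fun A ->
  poly_fun (fun u => f (tfst (tsnd u)) (tfst u) (tsnd (tsnd u))) ->
  (exists2 b, poly_bounded b & forall e x acc, code_size x <= code_size (L e) ->
     code_size (f acc x e) <= code_size acc + b (code_size e)) ->
  poly_fun (fun e => foldl (fun acc x => f acc x e) (A e) (items (L e))).
Proof.
move=> PL PA Pf [b bP b_le].
pose S u := Node (f (tfst (tsnd u)) (tfst u) (tsnd (tsnd u))) (tsnd (tsnd u)).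
have PS : poly_fun S.
  by apply: poly_fun_node => //; do 2!apply: poly_fun_tsnd; apply: poly_fun_id.
have E e s acc : foldl (step S) (Node acc e) s =
    Node (foldl (fun acc x => f acc x e) acc s) e.
  by elim: s acc => //= x s IH acc; rewrite -IH.
have PN : poly_fun (fun e => Node (A e) e) by apply: poly_fun_node => //; apply: poly_fun_id.
have [cA [kA HA]] := PA; have [cL [kL HL]] := PL.
have [k Hk] : poly_bounded (fun n => (n.+2 ^ kA + n.+2 ^ kL * b n + n).+1) by poly_bound.
have H := @poly_fun_fold_aux S L (fun e => Node (A e) e) k PS PL PN.
apply: (poly_fun_ext (F := fun e => tfst (foldl (step S) (Node (A e) e) (items (L e))))).
  by move=> e; rewrite E.
apply: poly_fun_tfst; apply: H => e j; rewrite E code_size_node.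
apply: leq_trans (Hk _); rewrite ltnS leq_add2r.
have {}HA := proj1 (HA e); have {}HL := proj1 (HL e).
apply: (@leq_trans (code_size (A e) + size (take j (items (L e))) * b (code_size e))); last first.
  apply: leq_add => //; rewrite leq_mul2r; apply/orP; right; rewrite size_take_min.
  by have := size_items (L e); lia.
have := all_small_items (leqnn (code_size (L e))).
elim: (items _) j (A e) => [|x s IH] j acc; first by rewrite leq_addr.
case: j => [|j] /= [le_x small_s]; first by rewrite leq_addr.
by have := IH j (f acc x e) small_s; have := b_le e x acc le_x; lia.
Qed.

Lemma poly_fun_app2 f X Y : poly_fun (fun u => f (tfst u) (tsnd u)) ->
  poly_fun X -> poly_fun Y -> poly_fun (fun e => f (X e) (Y e)).
Proof. by move=> Pf PX PY; apply: (poly_fun_comp Pf (poly_fun_node PX PY)). Qed.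

Lemma poly_fun_catrev F A : poly_fun F -> poly_fun A ->
  poly_fun (fun e => tree_seq (catrev (items (F e)) (items (A e)))).
Proof.
move=> PF PA; have [cF [k HF]] := PF.
apply: (poly_fun_ext (F := fun e => foldl (fun acc x => Node x acc) (A e) (items (F e)))).
  move=> e; rewrite -{1}[A e]itemsK; elim: (items (F e)) (items (A e)) => //= x s IH r.
  by rewrite -IH.
apply: (poly_fun_foldl (f := fun acc x _ => Node x acc)) => //.
  apply: poly_fun_node; first by apply: poly_fun_tfst; apply: poly_fun_id.
  by apply: poly_fun_tfst; apply: poly_fun_tsnd; apply: poly_fun_id.
exists (fun n => (n.+2 ^ k).+1); first by poly_bound.
by move=> e x acc le_x; have [] := HF e; rewrite code_size_node; lia.
Qed.

Lemma code_size_tree_seq s : code_size (tree_seq s) = (\sum_(x <- s) (code_size x).+1).+1.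
Proof.
elim: s => [|x s IH]; first by rewrite big_nil.
by rewrite /= code_size_node IH big_cons; lia.
Qed.

Lemma code_size_catrev s r :
  (code_size (tree_seq (catrev s r))).+1 =
  code_size (tree_seq s) + code_size (tree_seq r).
Proof.
elim: s r => [|x s IH] r //=; have := IH (x :: r); rewrite /= !code_size_node; lia.
Qed.

Definition tflat (f : tree -> tree) (t : tree) : tree :=
  tree_seq (flatten [seq items (f x) | x <- items t]).

Lemma poly_fun_tflat f L :
  poly_fun L -> poly_fun (fun u => f (tfst u) (tsnd u)) ->
  poly_fun (fun e => tflat (fun x => f x e) (L e)).
Proof.
move=> PL Pf; have [cf [k Hf]] := Pf; have [cL [kL HL]] := PL.
(* The fold produces the concatenation in reverse order; the outer [catrev] onto the empty list
   turns it round. *)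
apply: (poly_fun_ext (F := fun e => tree_seq (catrev (items
  (foldl (fun acc x => tree_seq (catrev (items (f x e)) (items acc))) Leaf (items (L e))))
  (items Leaf)))).
  move=> e; rewrite /tflat; congr tree_seq; rewrite [items Leaf]/=.
  have H (s : seq tree) r : foldl (fun acc x => tree_seq (catrev (items (f x e)) (items acc)))
      (tree_seq r) s = tree_seq (catrev (flatten [seq items (f x e) | x <- s]) r).
    by elim: s r => //= x s IH r; rewrite catrev_catl -IH tree_seqK.
  by rewrite (H _ [::]) tree_seqK catrev_catrevK cats0.
apply: poly_fun_catrev; last exact: poly_fun_const.
apply: (poly_fun_foldl (f := fun acc x e => tree_seq (catrev (items (f x e)) (items acc)))) => //.
- exact: poly_fun_const.
- apply: poly_fun_catrev; last by apply: poly_fun_tfst; apply: poly_fun_tsnd; apply: poly_fun_id.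
  apply: poly_fun_app2 => //; first by apply: poly_fun_tfst; apply: poly_fun_id.
  by do 2!apply: poly_fun_tsnd; apply: poly_fun_id.
exists (fun n => ((n.+2 ^ kL + n).+1).+2 ^ k); first by poly_bound.
move=> e x acc le_x.
have sf : code_size (f x e) <= ((code_size e).+2 ^ kL + code_size e).+3 ^ k.
  apply: leq_trans (proj1 (Hf (Node x e))) _; apply: leq_pow; rewrite code_size_node.
  by have [] := HL e; lia.
have := code_size_catrev (items (f x e)) (items acc).
by rewrite !itemsK; lia.
Qed.

Definition tmap (f : tree -> tree) (t : tree) : tree := tree_seq (map f (items t)).

Lemma poly_fun_tmap f L :
  poly_fun L -> poly_fun (fun u => f (tfst u) (tsnd u)) ->
  poly_fun (fun e => tmap (fun x => f x e) (L e)).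
Proof.
move=> PL Pf.
apply: (poly_fun_ext (F := fun e => tflat (fun x => Node (f x e) Leaf) (L e))).
  by move=> e; rewrite /tflat /tmap; elim: (items (L e)) => //= x s [->].
apply: (poly_fun_tflat (f := fun x e => Node (f x e) Leaf)) => //.
by apply: poly_fun_node => //; apply: poly_fun_const.
Qed.

Definition tfilter (P : tree -> tree) (t : tree) : tree :=
  tree_seq [seq x <- items t | is_node (P x)].

Lemma poly_fun_tfilter P L :
  poly_fun L -> poly_fun (fun u => P (tfst u) (tsnd u)) ->
  poly_fun (fun e => tfilter (fun x => P x e) (L e)).
Proof.
move=> PL PP.
apply: (poly_fun_ext (F := fun e =>
    tflat (fun x => if is_node (P x e) then Node x Leaf else Leaf) (L e))).
  move=> e; rewrite /tflat /tfilter.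
  by elim: (items (L e)) => //= x s; case: ifP => //= _ [->].
apply: (poly_fun_tflat (f := fun x e => if is_node (P x e) then Node x Leaf else Leaf)) => //.
apply: poly_fun_if => //; last exact: poly_fun_const.
by apply: poly_fun_node; [apply: poly_fun_tfst; apply: poly_fun_id | apply: poly_fun_const].
Qed.

Lemma code_size_tfilter P t : code_size (tfilter P t) <= code_size t.
Proof.
rewrite -{2}[t]itemsK /tfilter !code_size_tree_seq big_filter ltnS.
by rewrite [leqRHS](bigID (fun x => is_node (P x))) /= leq_addr.
Qed.

Ltac poly_fun_step :=
  cbv beta;
  match goal with
  | |- poly_fun (fun e => e) => exact: poly_fun_id
  | |- poly_fun (fun=> _) => exact: poly_fun_const
  | |- poly_fun (fun e => Node (@?F e) (@?G e)) => apply: poly_fun_node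
  | |- poly_fun id => exact: poly_fun_id
  | |- poly_fun tfst => apply: (poly_fun_tfst poly_fun_id)
  | |- poly_fun tsnd => apply: (poly_fun_tsnd poly_fun_id)
  | |- poly_fun (fun e => tfst (@?F e)) => apply: poly_fun_tfst
  | |- poly_fun (fun e => tsnd (@?F e)) => apply: poly_fun_tsnd
  | |- poly_fun (fun e => if is_node (@?C e) then _ else _) => apply: poly_fun_if
  | |- poly_fun (fun e => tflat _ _) => apply: poly_fun_tflat
  | |- poly_fun (fun e => tmap _ _) => apply: poly_fun_tmap
  | |- poly_fun (fun e => tfilter _ _) => apply: poly_fun_tfilter
  | H : poly_fun ?X |- poly_fun ?X => exact: H
  | H : poly_fun ?X |- poly_fun (fun e => ?X (@?G e)) => apply: (poly_fun_comp H)
  end.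

Ltac poly_fun_auto := repeat poly_fun_step.

(** On unary numbers this is truncated subtraction, on lists the removal of a prefix. Comparison,
    indexing and enumeration are all derived from it. *)
Definition tdrop (t u : tree) : tree := foldl (fun acc _ => tsnd acc) t (items u).

Lemma tdropE s u : tdrop (tree_seq s) u = tree_seq (drop (size (items u)) s).
Proof.
rewrite /tdrop; elim: (items u) s => [|x r IH] s /=; first by rewrite drop0.
by case: s => [|y s] /=; [apply: (IH [::])|apply: IH].
Qed.

Lemma code_size_tdrop t u : code_size (tdrop t u) <= code_size t.
Proof.
rewrite /tdrop; elim: (items u) t => //= x s IH t.
exact: leq_trans (IH _) (code_size_tsnd t).
Qed.

Lemma poly_fun_tdrop F G : poly_fun F -> poly_fun G ->
  poly_fun (fun e => tdrop (F e) (G e)).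
Proof.
move=> PF PG; apply: (poly_fun_foldl (f := fun acc _ _ => tsnd acc)) => //.
  by poly_fun_auto.
exists (fun=> 0); first by poly_bound.
by move=> e x acc _; rewrite addn0 code_size_tsnd.
Qed.

(** * Truth values, unary comparison, membership and enumeration *)

Definition tnot (t : tree) : tree := if is_node t then Leaf else Node Leaf Leaf.
Definition tand (t u : tree) : tree := if is_node t then u else Leaf.
Definition tor (t u : tree) : tree := if is_node t then t else u.

Lemma is_node_tnot t : is_node (tnot t) = ~~ is_node t.
Proof. by case: t. Qed.
Lemma is_node_tand t u : is_node (tand t u) = is_node t && is_node u.
Proof. by case: t. Qed.
Lemma is_node_tor t u : is_node (tor t u) = is_node t || is_node u.
Proof. by case: t. Qed.

Lemma poly_fun_tnot F : poly_fun F -> poly_fun (fun e => tnot (F e)).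
Proof. by move=> ?; apply: poly_fun_if => //; apply: poly_fun_const. Qed.
Lemma poly_fun_tand F G : poly_fun F -> poly_fun G -> poly_fun (fun e => tand (F e) (G e)).
Proof. by move=> ? ?; apply: poly_fun_if => //; apply: poly_fun_const. Qed.
Lemma poly_fun_tor F G : poly_fun F -> poly_fun G -> poly_fun (fun e => tor (F e) (G e)).
Proof. by move=> ? ?; apply: poly_fun_if. Qed.

Definition is_nodeE := (is_node_tnot, is_node_tand, is_node_tor).

Definition teq (t u : tree) : tree := tand (tnot (tdrop t u)) (tnot (tdrop u t)).
Definition tmem (t l : tree) : tree := tfilter (fun x => teq x t) l.
(** The list is built from its last entry: when [acc] has j entries, [tsnd (tdrop t acc)] is n - j -
    1, the next one to put in front. *)
Definition tiota (t : tree) : tree :=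
  foldl (fun acc _ => Node (tsnd (tdrop t acc)) acc) Leaf (items t).

Lemma poly_fun_teq F G : poly_fun F -> poly_fun G -> poly_fun (fun e => teq (F e) (G e)).
Proof.
move=> PF PG; apply: poly_fun_tand; apply: poly_fun_tnot; exact: poly_fun_tdrop.
Qed.

Lemma poly_fun_tmem F G : poly_fun F -> poly_fun G -> poly_fun (fun e => tmem (F e) (G e)).
Proof.
move=> PF PG; apply: poly_fun_tfilter => //; apply: poly_fun_teq; poly_fun_auto.
Qed.

Lemma poly_fun_tiota F : poly_fun F -> poly_fun (fun e => tiota (F e)).
Proof.
apply: (@poly_fun_comp tiota).
apply: (poly_fun_foldl (f := fun acc _ e => Node (tsnd (tdrop e acc)) acc)).
- exact: poly_fun_id.
- exact: poly_fun_const.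
- apply: poly_fun_node; last by poly_fun_auto.
  by apply: poly_fun_tsnd; apply: poly_fun_tdrop; poly_fun_auto.
exists S; first by poly_bound.
move=> e x acc _; rewrite code_size_node.
have := code_size_tsnd (tdrop e acc); have := code_size_tdrop e acc; lia.
Qed.

Lemma size_items_tree_unary n : size (items (tree_unary n)) = n.
Proof. by rewrite tree_seqK size_nseq. Qed.

Lemma tdrop_tree_unary m n : tdrop (tree_unary m) (tree_unary n) = tree_unary (m - n).
Proof. by rewrite tdropE size_items_tree_unary drop_nseq. Qed.

Lemma is_node_tree_unary n : is_node (tree_unary n) = (0 < n).
Proof. by case: n. Qed.

Lemma is_node_teq m n : is_node (teq (tree_unary m) (tree_unary n)) = (m == n).
Proof. by rewrite !is_nodeE !tdrop_tree_unary !is_node_tree_unary; lia. Qed.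

Lemma is_node_tree_seq s : is_node (tree_seq s) = (0 < size s).
Proof. by case: s. Qed.

Lemma is_node_tmem n s :
  is_node (tmem (tree_unary n) (tree_seq (map tree_unary s))) = (n \in s).
Proof.
rewrite is_node_tree_seq size_filter -has_count tree_seqK has_map.
by rewrite -has_pred1; apply: eq_has => m /=; rewrite is_node_teq.
Qed.

Lemma tiotaE n : tiota (tree_unary n) = tree_seq (map tree_unary (iota 0 n)).
Proof.
rewrite /tiota [X in foldl _ _ X]tree_seqK; set f := fun acc _ => _.
have H k : k <= n -> foldl f Leaf (nseq k Leaf) =
    tree_seq (map tree_unary (iota (n - k) k)).
  elim: k => // k IH lt_k; rewrite -addn1 nseqD foldl_cat IH 1?ltnW //= addn1 /f.
  rewrite tdropE tree_seqK size_map size_iota drop_nseq.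
  have -> : n - k = (n - k.+1).+1 by lia.
  by [].
by rewrite H // subnn.
Qed.

(** * Binary numerals *)

Definition ttrue : tree := Node Leaf Leaf.

Fixpoint inc (c : bool) (s : seq tree) : seq tree :=
  if s is x :: s' then
    if c then if is_node x then Leaf :: inc true s' else ttrue :: inc false s'
    else x :: inc false s'
  else if c then [:: ttrue] else [::].

(** One digit of [inc] as a fold step: the accumulator pairs the carry with the digits already
    produced, which are in reverse order until [inc_end]. *)
Definition inc_step (acc x : tree) : tree :=
  if is_node (tfst acc)
  then if is_node x then Node (tfst acc) (Node Leaf (tsnd acc))
       else Node Leaf (Node ttrue (tsnd acc))
  else Node Leaf (Node x (tsnd acc)).

Definition inc_end (r : tree) : tree :=
  tree_seq (catrev (items (if is_node (tfst r) then Node ttrue (tsnd r) else tsnd r))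
                   (items Leaf)).

Definition tinc (t : tree) : tree :=
  inc_end (foldl inc_step (Node ttrue Leaf) (items t)).

Lemma tincE t : tinc t = tree_seq (inc true (items t)).
Proof.
have H s c o : inc_end (foldl inc_step (Node (tree_bool c) (tree_seq o)) s) =
    tree_seq (catrev o (inc c s)).
  elim: s c o => [|x s IH] c o.
    by case: c; rewrite /inc_end /= tree_seqK ?catrevE //= catrevE rev_cons cats0 cats1.
  rewrite /=; case: c => /=; last exact: (IH false (x :: o)).
  by rewrite /inc_step /=; case: (is_node x); [apply: (IH true (Leaf :: o))|apply: (IH false (ttrue :: o))].
exact: (H _ true [::]).
Qed.

Lemma poly_fun_tinc : poly_fun tinc.
Proof.
apply: (poly_fun_comp (F := inc_end)).
  by apply: poly_fun_catrev; poly_fun_auto.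
apply: (poly_fun_foldl (f := fun acc x _ => inc_step acc x)); rewrite /inc_step; poly_fun_auto.
exists (fun n => n + 6); first by poly_bound.
have L1 : code_size Leaf = 1 by [].
move=> e x [|c o] le_x /=; first by rewrite !code_size_node; lia.
by case: c => [|c c'] /=; last case: (is_node x); rewrite /ttrue !code_size_node; lia.
Qed.

(** A carry shrinks the digits 1 that it clears, and then either turns one 0 into 1 or appends one
    digit. The worst case 4 is an appended [ttrue], of size 3, with its list node. The constant
    growth is what lets [tbinary] be a fold. *)
Lemma code_size_tinc t : code_size (tinc t) <= code_size t + 4.
Proof.
have H c s : code_size (tree_seq (inc c s)) <= code_size (tree_seq s) + 4 * c.
  have L1 : code_size Leaf = 1 by [].
  elim: s c => [|x s IH] [] //=.
    have := IH true; have := IH false; rewrite code_size_node.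
    by case: x => [|x x'] /=; rewrite /ttrue !code_size_node; lia.
  by have := IH false; rewrite !code_size_node; lia.
by rewrite tincE; have := H true (items t); rewrite itemsK.
Qed.

Definition tbinary (t : tree) : tree := foldl (fun acc _ => tinc acc) Leaf (items t).

Lemma poly_fun_tbinary F : poly_fun F -> poly_fun (fun e => tbinary (F e)).
Proof.
apply: (@poly_fun_comp tbinary); apply: (poly_fun_foldl (f := fun acc _ _ => tinc acc)).
- exact: poly_fun_id.
- exact: poly_fun_const.
- by apply: (poly_fun_comp poly_fun_tinc); poly_fun_auto.
by exists (fun=> 4); [poly_bound | move=> e x acc _; apply: code_size_tinc].
Qed.

Definition binary_bits (n : nat) : seq bool :=
  if bin_of_nat n is Npos m then positive_bits m else [::].

Lemma positive_bits_succ m :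
  map tree_bool (positive_bits (Pos.succ m)) = inc true (map tree_bool (positive_bits m)).
Proof.
have inc_false s : inc false s = s by elim: s => //= x s ->.
by elim: m => [m IH|m IH|] //=; rewrite ?IH ?inc_false.
Qed.

Lemma binary_bits_succ n :
  map tree_bool (binary_bits n.+1) = inc true (map tree_bool (binary_bits n)).
Proof.
rewrite /binary_bits; case E: (bin_of_nat n) => [|m].
  by have -> : n = 0 by rewrite -(bin_of_natK n) E.
rewrite -positive_bits_succ.
suff -> : bin_of_nat n.+1 = Npos (Pos.succ m) by [].
apply: (can_inj nat_of_binK); rewrite bin_of_natK -[in LHS](bin_of_natK n) E /=.
by rewrite nat_of_succ_pos.
Qed.

Lemma tbinaryE n : tbinary (tree_unary n) = tree_binary n.
Proof.
rewrite /tbinary tree_seqK; elim: n => // n IH.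
by rewrite -addn1 nseqD foldl_cat IH /= tincE addn1 tree_seqK -binary_bits_succ.
Qed.

(** * The two transformations as tree functions *)

Definition tinst_n (e : tree) : tree := tfst (tfst e).
Definition tinst_arcs (e : tree) : tree := tsnd (tfst e).
Definition tinst_pairs (e : tree) : tree := tsnd e.

Definition tsources (e : tree) : tree := tmap (fun p => tfst p) (tinst_pairs e).

(** Follows [fixset] round by round: n rounds from the empty set reach the least fixed point. The
    list folded over serves only as a counter. *)
Definition treach (e : tree) : tree :=
  foldl (fun R _ =>
    tfilter (fun v => tor (tmem v (tsources e))
        (tfilter (fun a => tand (teq (tsnd (tfst a)) v) (tmem (tfst (tfst a)) R))
                 (tinst_arcs e)))
      (tiota (tinst_n e)))
    Leaf (items (tinst_n e)).

Definition tlength (t : tree) : tree := tmap (fun=> Leaf) t.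

Definition tattach (e : tree) : tree :=
  tflat (fun i =>
      tmap (fun k => if is_node (tdrop i k) then tfst (tfst (tdrop (tinst_pairs e) i))
                     else tsnd (tfst (tdrop (tinst_pairs e) i)))
        (tiota (tlength (tinst_pairs e))))
    (tiota (tlength (tinst_pairs e))).

Definition tcat (t u : tree) : tree := tflat id (Node t (Node u Leaf)).

(* From here on the tree instance is extended to [Node R (Node T e)] with the
   list [R] of reachable vertices and the list [T] of attachment points. *)
Definition ext_reach (x : tree) : tree := tfst x.
Definition ext_attach (x : tree) : tree := tfst (tsnd x).
Definition ext_inst (x : tree) : tree := tsnd (tsnd x).

Definition tsize_new (x : tree) : tree :=
  tcat (Node Leaf (tinst_n (ext_inst x))) (tlength (ext_attach x)).

Definition tlookup (x v w : tree) : tree :=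
  tfilter (fun a => tand (teq (tfst (tfst a)) v) (teq (tsnd (tfst a)) w))
    (tinst_arcs (ext_inst x)).

Definition tanchor (x w : tree) : tree :=
  if is_node (teq w (tsnd (tfst (tinst_pairs (ext_inst x)))))
  then tfst (tfst (tsnd (tinst_pairs (ext_inst x))))
  else tfst (tfst (tinst_pairs (ext_inst x))).

(** Numbering of the new vertices: those below n are the old ones, n is the root, and n + 1 + i p +
    k is terminal k of pair i, with entry i p + k of the attachment list as its neighbour. *)
Definition tnew_arc (x v w : tree) : tree :=
  let n := tinst_n (ext_inst x) in
  if is_node (tdrop n w) then
    if is_node (tdrop n v) then
      tor (tand (tmem v (ext_reach x)) (tlookup x v w))
          (tand (tnot (tmem w (ext_reach x))) (teq v (tanchor x w)))
    else tand (teq v n) (tmem w (tsources (ext_inst x)))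
  else if is_node (teq w n) then Leaf
  else teq v (tfst (tdrop (ext_attach x) (tdrop w (Node Leaf n)))).

Definition tnew_arcs (directed : bool) (x : tree) : tree :=
  tflat (fun v => tflat (fun w =>
      if is_node (tor (tnew_arc x v w)
                      (tand (tree_bool (~~ directed)) (tnew_arc x w v)))
      then Node (Node (Node v w)
             (if is_node (tlookup x v w) then tsnd (tfst (tlookup x v w))
              else tree_rat 0)) Leaf
      else Leaf)
    (tiota (tsize_new x))) (tiota (tsize_new x)).

Definition tnew_instance (directed : bool) (x : tree) : tree :=
  Node (Node (tsize_new x) (tnew_arcs directed x))
    (Node (tmap (fun=> tbinary (tlength (tinst_pairs (ext_inst x)))) (tnew_arcs directed x))
      (Node (tfilter (fun v => tdrop v (tinst_n (ext_inst x))) (tiota (tsize_new x)))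
        (tinst_n (ext_inst x)))).

Definition tforward (directed : bool) (e : tree) : tree :=
  tnew_instance directed (Node (treach e) (Node (tattach e) e)).

Definition tparents (e v : tree) : tree :=
  tfilter (fun a => tand (teq (tsnd a) v) (tdrop (tinst_n (tfst e)) (tfst a))) (tsnd e).

(** Only arcs with an old tail count as parents, so the walk upwards stops below the root and the
    remaining rounds are idle. A path has at most n vertices, so n rounds are enough. *)
Definition twalk (e v : tree) : tree :=
  foldl (fun acc _ =>
      if is_node (tparents e (tfst acc))
      then Node (tfst (tfst (tparents e (tfst acc)))) acc else acc)
    (Node v Leaf) (items (tinst_n (tfst e))).

Definition tbackward (e : tree) : tree :=
  tmap (fun p => twalk e (tsnd p)) (tinst_pairs (tfst e)).

Ltac poly_fun_unfold := rewrite /ext_reach /ext_attach /ext_inst /tinst_n /tinst_arcs /tinst_pairs.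

Ltac poly_fun_solve := repeat first
  [ poly_fun_step
  | cbv beta; match goal with
    | |- poly_fun (fun e => tdrop (@?F e) (@?G e)) => apply: poly_fun_tdrop
    | |- poly_fun (fun e => teq (@?F e) (@?G e)) => apply: poly_fun_teq
    | |- poly_fun (fun e => tmem (@?F e) (@?G e)) => apply: poly_fun_tmem
    | |- poly_fun (fun e => tand (@?F e) (@?G e)) => apply: poly_fun_tand
    | |- poly_fun (fun e => tor (@?F e) (@?G e)) => apply: poly_fun_tor
    | |- poly_fun (fun e => tnot (@?F e)) => apply: poly_fun_tnot
    | |- poly_fun (fun e => tiota (@?F e)) => apply: poly_fun_tiota
    | |- poly_fun (fun e => tbinary (@?F e)) => apply: poly_fun_tbinary
    end ].

Lemma poly_fun_treach F : poly_fun F -> poly_fun (fun e => treach (F e)).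
Proof.
apply: (@poly_fun_comp treach).
apply: (poly_fun_foldl (f := fun R _ e => tfilter (fun v => tor (tmem v (tsources e))
        (tfilter (fun a => tand (teq (tsnd (tfst a)) v) (tmem (tfst (tfst a)) R))
                 (tinst_arcs e)))
      (tiota (tinst_n e)))); rewrite /tsources; poly_fun_unfold; poly_fun_solve.
(* Each round returns a sublist of all vertex names, whose size is bounded independently of the
   accumulator. *)
have [c [k H]] : poly_fun (fun e => tiota (tfst (tfst e))) by poly_fun_solve.
exists (fun n => n.+2 ^ k); first by poly_bound.
by move=> e x acc _; apply: leq_trans (code_size_tfilter _ _) _; have [] := H e; lia.
Qed.

Lemma poly_fun_tattach F : poly_fun F -> poly_fun (fun e => tattach (F e)).
Proof.
apply: (@poly_fun_comp tattach).
by rewrite /tattach /tlength; poly_fun_unfold; poly_fun_solve.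
Qed.

Lemma poly_fun_app3 f X Y Z :
  poly_fun (fun u => f (tfst u) (tfst (tsnd u)) (tsnd (tsnd u))) ->
  poly_fun X -> poly_fun Y -> poly_fun Z -> poly_fun (fun e => f (X e) (Y e) (Z e)).
Proof.
move=> Pf PX PY PZ.
exact: (poly_fun_comp Pf (poly_fun_node PX (poly_fun_node PY PZ))).
Qed.

Lemma poly_fun_tsize_new F : poly_fun F -> poly_fun (fun e => tsize_new (F e)).
Proof.
apply: (@poly_fun_comp tsize_new); rewrite /tsize_new /tcat /tlength; poly_fun_unfold.
by apply: (poly_fun_tflat (f := fun x _ => x)); poly_fun_solve.
Qed.

Lemma poly_fun_tlookup X V W : poly_fun X -> poly_fun V -> poly_fun W ->
  poly_fun (fun e => tlookup (X e) (V e) (W e)).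
Proof. by apply: poly_fun_app3; rewrite /tlookup; poly_fun_unfold; poly_fun_solve. Qed.

Lemma poly_fun_tnew_arc X V W : poly_fun X -> poly_fun V -> poly_fun W ->
  poly_fun (fun e => tnew_arc (X e) (V e) (W e)).
Proof.
apply: poly_fun_app3; rewrite /tnew_arc /tanchor /tsources; poly_fun_unfold.
by repeat first [progress poly_fun_solve | apply: poly_fun_tlookup].
Qed.

Lemma poly_fun_tnew_arcs directed : poly_fun (tnew_arcs directed).
Proof.
rewrite /tnew_arcs; apply: poly_fun_tflat; first by apply: poly_fun_tiota; apply: poly_fun_tsize_new; apply: poly_fun_id.
apply: poly_fun_tflat; first by apply: poly_fun_tiota; apply: poly_fun_tsize_new; poly_fun_auto.
by repeat first [progress poly_fun_solve | apply: poly_fun_tlookup | apply: poly_fun_tnew_arc].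
Qed.

Lemma poly_fun_tforward directed : poly_fun (tforward directed).
Proof.
apply: (@poly_fun_comp (tnew_instance directed)).
  rewrite /tnew_instance /tlength; poly_fun_unfold.
  by repeat first [progress poly_fun_solve | apply: poly_fun_tsize_new
    | apply: (poly_fun_tnew_arcs directed)].
apply: poly_fun_node; first by apply: poly_fun_treach; apply: poly_fun_id.
by apply: poly_fun_node; [apply: poly_fun_tattach|]; apply: poly_fun_id.
Qed.

Lemma poly_fun_tbackward : poly_fun tbackward.
Proof.
rewrite /tbackward; apply: poly_fun_tmap; first by poly_fun_unfold; poly_fun_solve.
apply: (@poly_fun_app2 (fun p e => twalk e (tsnd p))); [|poly_fun_solve|poly_fun_solve].
rewrite /twalk.
apply: (poly_fun_foldl (f := fun acc _ u =>
      if is_node (tparents (tsnd u) (tfst acc))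
      then Node (tfst (tfst (tparents (tsnd u) (tfst acc)))) acc else acc));
  rewrite /tparents; poly_fun_unfold; poly_fun_solve.
(* The vertex put in front is a piece of the arc list in [e], so a round adds at most the size of
   [e] and one node. *)
exists S; first by poly_bound.
move=> e x acc _; case: ifP => _; last by lia.
rewrite code_size_node.
set P := tfilter _ _; have : code_size P <= code_size (tsnd (tsnd e)) by apply: code_size_tfilter.
have := code_size_tfst P; have := code_size_tfst (tfst P).
have := code_size_tsnd (tsnd e); have := code_size_tsnd e; lia.
Qed.

(** * The reduction *)

Section Reduction.

Variables (directed : bool) (I : vdp_instance).
Let G := vdp_graph I.
Let n := nverts G.
Let p := vdp_num I.

Definition pairs_nat : seq (nat * nat) := [seq (val pr.1, val pr.2) | pr <- vdp_pairs I].
Definition source (i : nat) : nat := (nth (0, 0) pairs_nat i).1.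
Definition sink (i : nat) : nat := (nth (0, 0) pairs_nat i).2.

Definition reach_step (R : {set 'I_n}) : {set 'I_n} :=
  [set v | (v \in unzip1 (vdp_pairs I)) || [exists u in R, (u, v) \in arcs G]].

Definition reach : {set 'I_n} := fixset reach_step.
Definition reach_nat : seq nat := [seq val v | v <- enum reach].

Definition attach : seq nat :=
  flatten [seq [seq (if k < i then source i else sink i) | k <- iota 0 p] | i <- iota 0 p].

(* Unreachable vertices are hung here; the case distinction makes sure that an
   unreachable sink is never hung on its own source. *)
Definition anchor (w : nat) : nat := if w == sink 0 then source 1 else source 0.

Definition arcs_between (v w : nat) : seq ('I_n * 'I_n) :=
  [seq e <- enum (arcs G) | (val e.1 == v) && (val e.2 == w)].

Definition new_arc (v w : nat) : bool :=
  if w < n then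
    if v < n then
      (v \in reach_nat) && (0 < size (arcs_between v w))
      || (w \notin reach_nat) && (v == anchor w)
    else (v == n) && (w \in unzip1 pairs_nat)
  else if w == n then false
  else v == nth 0 attach (w - n.+1).

Definition new_edge (v w : nat) : bool :=
  new_arc v w || ~~ directed && new_arc w v.

(** At most one arc matches, and the default 0 is the length of the new arcs. *)
Definition new_len (v w : nat) : rat :=
  head 0%R [seq len G e | e <- arcs_between v w].

Definition new_size : nat := n.+1 + p ^ 2.

Definition new_root : 'I_new_size := Ordinal (leq_addr (p ^ 2) n.+1).

Definition new_graph : lgraph :=
  @LGraph new_size [set e : 'I_new_size * 'I_new_size | new_edge e.1 e.2]
    [ffun e : 'I_new_size * 'I_new_size => new_len e.1 e.2].

Definition cst_of_vdp : cst_instance :=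
  @CST new_graph [ffun=> p] [set v : 'I_new_size | n < v] new_root.

Definition parent_step (S : seq (nat * nat)) (w : seq nat) : seq nat :=
  if [seq a <- S | (a.2 == head 0 w) && (a.1 < n)] is a :: _ then a.1 :: w else w.

Definition arcs_nat (m : nat) (S : {set 'I_m * 'I_m}) : seq (nat * nat) :=
  [seq (val e.1, val e.2) | e <- enum S].

Definition walk_back (S : seq (nat * nat)) (v : nat) : seq nat :=
  iter n (parent_step S) [:: v].

Definition vdp_of_cst (S : cst_candidate cst_of_vdp) : vdp_candidate I :=
  map_tuple (fun pr => pmap insub (walk_back (arcs_nat S) (val pr.2))) (vdp_pairs I).

End Reduction.

(** * Agreement of the tree functions with the two transformations *)

Lemma tflat_unary f s :
  tflat f (tree_seq (map tree_unary s)) = tree_seq (flatten [seq items (f (tree_unary x)) | x <- s]).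
Proof. by rewrite /tflat tree_seqK -map_comp. Qed.

(** The code of a graph depends on the order in which [enum] lists the arcs. This order is
    lexicographic, hence that of two nested loops. *)
Lemma map_enum_set_ord (T : Type) (N : nat) (P : nat -> nat -> bool) (h : nat -> nat -> T) :
  [seq h (val e.1) (val e.2) | e : 'I_N * 'I_N <- enum [set e : 'I_N * 'I_N | P e.1 e.2]] =
  flatten [seq flatten [seq if P v w then [:: h v w] else [::] | w <- iota 0 N]
          | v <- iota 0 N].
Proof.
rewrite /enum_mem (eq_filter (a2 := fun e : 'I_N * 'I_N => P e.1 e.2)); last first.
  by move=> e; rewrite !inE.
rewrite unlock /= /prod_enum -val_enum_ord.
elim: {2 4}(enum 'I_N) => //= v s IH.
rewrite filter_cat map_cat {}IH -!map_comp; congr (_ ++ _).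
by elim: (Finite.enum _) => //= w r <-; case: ifP.
Qed.

Lemma foldl_iter (h : tree -> tree) a n :
  foldl (fun acc _ => h acc) a (nseq n Leaf) = iter n h a.
Proof. by elim: n a => //= n IH a; rewrite IH -iterSr. Qed.

Lemma tcatE s r : tcat (tree_seq s) (tree_seq r) = tree_seq (s ++ r).
Proof. by rewrite /tcat /tflat /= !tree_seqK cats0. Qed.

Lemma tlengthE s : tlength (tree_seq s) = tree_unary (size s).
Proof. by rewrite /tlength /tmap tree_seqK; elim: s => //= x s IH; congr Node. Qed.

Lemma tfst_tdrop s u x0 : size (items u) < size s ->
  tfst (tdrop (tree_seq s) u) = nth x0 s (size (items u)).
Proof. by move=> lt_u; rewrite tdropE (drop_nth x0). Qed.

Lemma tmap_tree_seq (T : Type) f (h : T -> tree) s :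
  tmap f (tree_seq (map h s)) = tree_seq [seq f (h x) | x <- s].
Proof. by rewrite /tmap tree_seqK -map_comp. Qed.

Lemma tfilter_tree_seq (T : Type) P (h : T -> tree) s :
  tfilter P (tree_seq (map h s)) = tree_seq [seq h x | x <- s & is_node (P (h x))].
Proof. by rewrite /tfilter tree_seqK filter_map. Qed.

Section Correctness.

Variables (directed : bool) (I : vdp_instance).
Let G := vdp_graph I.
Let n := nverts G.
Let p := vdp_num I.
Hypothesis p_gt1 : 1 < p.

Let e := tree_vdp I.

Lemma size_pairs_nat : size (pairs_nat I) = p.
Proof. by rewrite size_map size_tuple. Qed.

Lemma tinst_pairsE :
  tinst_pairs e = tree_seq [seq Node (tree_unary a.1) (tree_unary a.2) | a <- pairs_nat I].
Proof. by rewrite /tinst_pairs /= -map_comp. Qed.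

Lemma tsourcesE : tsources e = tree_seq (map tree_unary (unzip1 (pairs_nat I))).
Proof. by rewrite /tsources tinst_pairsE tmap_tree_seq /unzip1 -map_comp. Qed.

Lemma tinst_arcsE : tinst_arcs e =
  tree_seq [seq Node (tree_arc a) (tree_rat (len G a)) | a <- enum (arcs G)].
Proof. by []. Qed.

Lemma enum_ord_set (P : pred nat) (A : {set 'I_n}) : (forall v, (v \in A) = P (val v)) ->
  [seq val v | v <- enum A] = [seq v <- iota 0 n | P v].
Proof.
move=> AP; rewrite -val_enum_ord filter_map {1}/enum_mem -enumT.
by congr map; apply: eq_filter => v; rewrite /= AP.
Qed.

Lemma treachE : treach e = tree_seq (map tree_unary (reach_nat I)).
Proof.
rewrite /treach [tinst_n _]/= tree_seqK foldl_iter -/n.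
set h := (X in iter _ X _).
rewrite /reach_nat /reach /fixset card_ord.
suff H k : iter k h Leaf = tree_seq (map tree_unary
    [seq val v | v <- enum (iter k (@reach_step I) set0)]) by apply: H.
elim: k => [|k IH]; first by rewrite /= enum_set0.
rewrite iterS {}IH [in RHS]iterS; set R := iter k _ _.
rewrite /h tiotaE tfilter_tree_seq; congr tree_seq; congr map.
symmetry; apply: enum_ord_set => v; rewrite inE is_node_tor tsourcesE is_node_tmem.
congr (_ || _).
  rewrite /unzip1 /pairs_nat -!map_comp.
  have -> : map (fst \o (fun pr : 'I_n * 'I_n => (val pr.1, val pr.2))) (vdp_pairs I) =
    map val (unzip1 (vdp_pairs I)) by rewrite /unzip1 -map_comp.
  by rewrite mem_map //; apply: val_inj.
rewrite tinst_arcsE tfilter_tree_seq is_node_tree_seq size_map size_filter -has_count.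
apply/existsP/hasP => [[u /andP[uR uv]]|[[u w]]].
  exists (u, v); first by rewrite mem_enum.
  by rewrite /= is_node_tand is_node_teq eqxx is_node_tmem mem_map ?mem_enum //; apply: val_inj.
rewrite mem_enum /= is_node_tand is_node_teq is_node_tmem => uw /andP[/eqP/val_inj <-].
by rewrite mem_map ?mem_enum => [uR|]; [exists u; rewrite uR|apply: val_inj].
Qed.

Lemma tattachE : tattach e = tree_seq (map tree_unary (attach I)).
Proof.
rewrite /tattach tinst_pairsE tlengthE size_map size_pairs_nat tiotaE tflat_unary.
rewrite /attach map_flatten -map_comp; congr (tree_seq (flatten _)).
apply/eq_in_map => i; rewrite mem_iota add0n /= => lt_ip.
rewrite tmap_tree_seq tree_seqK -map_comp; apply: eq_map => k /=.
rewrite tdrop_tree_unary is_node_tree_unary subn_gt0.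
have lt_i : size (items (tree_unary i)) < size
    [seq Node (tree_unary a.1) (tree_unary a.2) | a <- pairs_nat I].
  by rewrite size_items_tree_unary size_map size_pairs_nat.
rewrite (tfst_tdrop Leaf lt_i) size_items_tree_unary (nth_map (0, 0)) ?size_pairs_nat //.
by case: ifP.
Qed.

Lemma size_attach : size (attach I) = p ^ 2.
Proof.
rewrite /attach size_flatten /shape -map_comp.
rewrite (eq_map (g := fun=> p)); last by move=> i /=; rewrite size_map size_iota.
by rewrite sumnE big_map big_const_seq iter_addn_0 count_predT size_iota mulnn.
Qed.

Let x := Node (treach e) (Node (tattach e) e).

Lemma tsize_newE : tsize_new x = tree_unary (new_size I).
Proof.
rewrite /tsize_new -[ext_attach x]/(tattach e) tattachE tlengthE size_map size_attach.
rewrite -[Node Leaf (tinst_n _)]/(tree_unary n.+1) tcatE.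
by rewrite -nseqD.
Qed.

Lemma tlookupE v w : tlookup x (tree_unary v) (tree_unary w) =
  tree_seq [seq Node (tree_arc a) (tree_rat (len G a)) | a <- arcs_between I v w].
Proof.
rewrite /tlookup /ext_inst [tsnd (tsnd _)]/= tinst_arcsE tfilter_tree_seq.
by congr (tree_seq (map _ _)); apply: eq_filter => a /=; rewrite is_node_tand !is_node_teq.
Qed.

Lemma nth_pairs_ex : exists a b s, pairs_nat I = [:: a, b & s].
Proof.
move: size_pairs_nat p_gt1; case: (pairs_nat I) => [|a [|b s]] /= <- //.
by exists a, b, s.
Qed.

Lemma tanchorE w : tanchor x (tree_unary w) = tree_unary (anchor I w).
Proof.
rewrite /tanchor /ext_inst [tsnd (tsnd _)]/= tinst_pairsE /anchor /sink /source.
have [a [b [s ->]]] := nth_pairs_ex; rewrite /= is_node_teq.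
by case: ifP.
Qed.

Lemma is_node_tnew_arc v w : w < new_size I ->
  is_node (tnew_arc x (tree_unary v) (tree_unary w)) = new_arc I v w.
Proof.
move=> lt_w; rewrite /tnew_arc /new_arc -/n.
have -> : tinst_n (ext_inst x) = tree_unary n by [].
rewrite !tdrop_tree_unary !is_node_tree_unary !subn_gt0.
case: ifP => w_n; first case: ifP => v_n.
- rewrite is_node_tor 2!is_node_tand is_node_tnot tlookupE is_node_tree_seq size_map tanchorE is_node_teq.
  by rewrite -[ext_reach x]/(treach e) treachE !is_node_tmem.
- by rewrite is_node_tand is_node_teq -[ext_inst x]/e tsourcesE is_node_tmem.
rewrite is_node_teq; case: ifP => // w_neq_n.
rewrite -[Node Leaf _]/(tree_unary n.+1) tdrop_tree_unary -[ext_attach x]/(tattach e) tattachE.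
have lt_a : w - n.+1 < size (attach I).
  by move: lt_w w_n w_neq_n; rewrite size_attach /new_size -/n -/p; lia.
rewrite (tfst_tdrop Leaf) size_items_tree_unary ?size_map //.
by rewrite (nth_map 0) // is_node_teq.
Qed.

Lemma tnew_arcsE : tnew_arcs directed x =
  tree_seq [seq Node (tree_arc a) (tree_rat (len (new_graph directed I) a))
           | a <- enum (arcs (new_graph directed I))].
Proof.
rewrite /tnew_arcs tsize_newE tiotaE tflat_unary; congr tree_seq.
have H := map_enum_set_ord (new_size I) (new_edge directed I)
  (fun v w => Node (Node (tree_unary v) (tree_unary w)) (tree_rat (new_len I v w))).
apply: esym; apply: etrans.
  by apply: (etrans _ H); apply: eq_map => a; rewrite ffunE.
congr flatten; apply/eq_in_map => v; rewrite mem_iota add0n => /andP[_ lt_v].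
rewrite tflat_unary tree_seqK; congr flatten.
apply/eq_in_map => w; rewrite mem_iota add0n => /andP[_ lt_w].
rewrite !is_nodeE !is_node_tnew_arc // /new_edge.
have -> : is_node (tree_bool (~~ directed)) = ~~ directed by case: (directed).
rewrite tlookupE is_node_tree_seq size_map; case: ifP => // _.
congr [:: Node _ _]; rewrite /new_len.
by case: (arcs_between I v w).
Qed.

Lemma tforwardE : tforward directed e = tree_cst (cst_of_vdp directed I).
Proof.
rewrite /tforward /tnew_instance -/e -/x tnew_arcsE tsize_newE /tree_cst.
rewrite /ext_inst [tsnd (tsnd _)]/= tinst_pairsE tlengthE size_map size_pairs_nat tbinaryE.
congr (Node _ (Node _ (Node _ _))).
  by rewrite tmap_tree_seq; congr tree_seq; apply: eq_map => a; rewrite ffunE.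
rewrite tiotaE tfilter_tree_seq /cst_of_vdp [cst_terminals _]/=; congr tree_seq.
rewrite -(val_enum_ord (new_size I)) filter_map -map_comp.
rewrite [in RHS]/enum_mem; congr map; rewrite enumT.
apply: eq_filter => v /=.
by rewrite inE [tinst_n _]/= tdrop_tree_unary is_node_tree_unary subn_gt0.
Qed.

Lemma walk_backE (S : cst_candidate (cst_of_vdp directed I)) v :
  twalk (Node e (tree_cst_candidate S)) (tree_unary v) =
  tree_seq (map tree_unary (walk_back I (arcs_nat S) v)).
Proof.
rewrite /twalk [tinst_n _]/= tree_seqK.
rewrite foldl_iter -/n; set h := (X in iter _ X _).
rewrite /walk_back -/n; elim: (n) => //= k ->.
set w := iter k _ _.
rewrite /h /tparents /parent_step -/n.
have -> : tsnd (Node e (tree_cst_candidate S)) =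
   tree_seq [seq Node (tree_unary a.1) (tree_unary a.2) | a <- arcs_nat S].
  by rewrite /= /tree_cst_candidate /arcs_nat -map_comp.
rewrite tfilter_tree_seq.
have w_head : tfst (tree_seq (map tree_unary w)) = tree_unary (head 0 w) by case: (w).
rewrite (eq_filter (a2 := fun a => (a.2 == head 0 w) && (a.1 < n))); last first.
  move=> a; rewrite is_node_tand [tsnd _]/= [tfst (Node (tree_unary _) _)]/= w_head.
  by rewrite is_node_teq tdrop_tree_unary is_node_tree_unary subn_gt0.
by case: [seq _ <- _ | _].
Qed.

(** Guarantees that [pmap insub] in [vdp_of_cst] discards nothing, so that its code is the list
    computed on trees. *)
Lemma walk_back_lt (S : seq (nat * nat)) (v : 'I_n) : all (fun k => k < n) (walk_back I S v).
Proof.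
rewrite /walk_back -/n; elim: {2}n => [|k IH]; first by rewrite /= ltn_ord.
rewrite iterS /parent_step; case E: [seq _ <- _ | _] => [//|a r].
have : a \in [seq a <- S | (a.2 == head 0 (iter k (parent_step I S) [:: val v])) && (a.1 < n)].
  by rewrite E inE eqxx.
by rewrite mem_filter => /andP[/andP[_ lt_a] _]; rewrite /= lt_a.
Qed.

Lemma tbackwardE (S : cst_candidate (cst_of_vdp directed I)) :
  tbackward (Node e (tree_cst_candidate S)) = tree_vdp_candidate (vdp_of_cst S).
Proof.
rewrite /tbackward /tree_vdp_candidate tmap_tree_seq -map_comp; congr tree_seq.
apply: eq_map => pr /=; rewrite walk_backE; congr tree_seq.
set w := walk_back _ _ _.
have /all_filterP <- : all (fun k => k < n) w by apply: walk_back_lt.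
elim: w => //= k w IH; case: ifP => //= lt_k.
by rewrite insubT /= IH.
Qed.

End Correctness.

(** * Trees directed away from a root *)

Section OutTree.

Variables (n : nat) (r : 'I_n) (S : {set 'I_n * 'I_n}).

Lemma spanned_root : r \in spanned r S.
Proof. by rewrite !inE eqxx. Qed.

Lemma spanned_tail a b : (a, b) \in S -> a \in spanned r S.
Proof.
by move=> ab; rewrite !inE; apply/orP; left; apply/orP; right; apply/imsetP; exists (a, b).
Qed.

Lemma spanned_head a b : (a, b) \in S -> b \in spanned r S.
Proof. by move=> ab; rewrite !inE; apply/orP; right; apply/imsetP; exists (a, b). Qed.

Lemma spanned_path a w : path (arc_rel S) a w -> a \in spanned r S ->
  last a w \in spanned r S.
Proof.
elim: w a => //= b w IH a /andP[ab pw] _; apply: IH pw _; exact: spanned_head ab.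
Qed.

Section Theory.

Hypothesis tree_S : out_tree r S.

Lemma out_tree_walk v : v \in spanned r S ->
  exists w, path (arc_rel S) r w /\ last r w = v.
Proof. by move=> /tree_S [w [[? ?] _]]; exists w. Qed.

Lemma out_tree_walk_eq w1 w2 : path (arc_rel S) r w1 -> path (arc_rel S) r w2 ->
  last r w1 = last r w2 -> w1 = w2.
Proof.
move=> p1 p2 E; have /tree_S [w [_ Hw]] := spanned_path p1 spanned_root.
by rewrite -(Hw w1) // -(Hw w2).
Qed.

Lemma out_tree_parent a b v : (a, v) \in S -> (b, v) \in S -> a = b.
Proof.
move=> av bv.
have [wa [pa la]] := out_tree_walk (spanned_tail av).
have [wb [pb lb]] := out_tree_walk (spanned_tail bv).
have : rcons wa v = rcons wb v.
  by apply: out_tree_walk_eq; rewrite ?rcons_path ?pa ?pb ?la ?lb ?last_rcons.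
by move/rcons_inj => [E]; rewrite -la -lb E.
Qed.

Lemma out_tree_root a : (a, r) \notin S.
Proof.
apply/negP=> ar; have [w [pw lw]] := out_tree_walk (spanned_tail ar).
have : rcons w r = [::].
  by apply: out_tree_walk_eq; rewrite ?rcons_path ?pw ?lw ?last_rcons.
by case: (w).
Qed.

Lemma out_tree_branch u u' v : (r, u) \in S -> (r, u') \in S ->
  connect (arc_rel S) u v -> connect (arc_rel S) u' v -> u = u'.
Proof.
move=> ru ru' /connectP[w pw lw] /connectP[w' pw' lw'].
by have [] : u :: w = u' :: w'
  by apply: out_tree_walk_eq => /=; [apply/andP|apply/andP|rewrite -lw -lw'].
Qed.

Lemma out_tree_in_branch v : v \in spanned r S -> v != r ->
  exists2 u, (r, u) \in S & connect (arc_rel S) u v.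
Proof.
move=> /out_tree_walk[[|u w] [/= pw <-]]; first by rewrite eqxx.
by move=> _; case/andP: pw => ru pw; exists u => //; apply/connectP; exists w.
Qed.

Lemma out_tree_last_arc v : v \in spanned r S -> v != r -> exists u, (u, v) \in S.
Proof.
move=> /out_tree_walk[w [pw <-]]; case: (lastP w) pw => [|w' u]; first by rewrite eqxx.
by rewrite rcons_path last_rcons => /andP[_ H] _; exists (last r w').
Qed.

(** Shortcutting the path yields one without repetitions and with the same ends; prefixed by a walk
    from the root to [a], both become walks to the same vertex and therefore coincide. *)
Lemma out_tree_path_uniq a w : a \in spanned r S -> path (arc_rel S) a w -> uniq (a :: w).
Proof.
move=> /out_tree_walk[w0 [p0 l0]] pw.
have [w' [pw' uw' E]] : exists w', [/\ path (arc_rel S) a w', uniq (a :: w') &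
    last a w' = last a w] by case/shortenP: (pw) => w' ? ? _; exists w'.
suff -> : w = w' by [].
have : w0 ++ w = w0 ++ w'.
  by apply: out_tree_walk_eq; rewrite ?last_cat ?cat_path ?p0 ?l0 ?pw ?pw' ?E.
by move/eqP; rewrite eqseq_cat // eqxx => /eqP.
Qed.

End Theory.

(** Two walks from the root to the same vertex agree when compared from their last arcs: each vertex
    has one parent, and the root, having none, forces both to end together. *)
Lemma out_tree_intro :
  (forall a b v, (a, v) \in S -> (b, v) \in S -> a = b) ->
  (forall a, (a, r) \notin S) ->
  (forall v, v \in spanned r S -> connect (arc_rel S) r v) ->
  out_tree r S.
Proof.
move=> parent_eq no_root conn v /conn /connectP[w pw ->]; exists w; split=> // w' [].
elim/last_ind: w w' pw => [|w x IH] w' pw pw'.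
  case: (lastP w') pw' => // w0 y; rewrite rcons_path last_rcons /= => /andP[_ H] E.
  by case/negP: (no_root (last r w0)); move: H; rewrite E.
rewrite last_rcons; case: (lastP w') pw' => [|w0 y] pw' /=.
  by move=> E; move: pw; rewrite rcons_path -E => /andP[_ H]; case/negP: (no_root (last r w)).
rewrite last_rcons => E; subst y; move: pw pw'; rewrite !rcons_path => /andP[pw ax] /andP[pw' bx].
by rewrite (IH w0) //; apply: (parent_eq _ _ _ bx ax).
Qed.

End OutTree.

(** * Consecutive pairs and sums over lists *)

Section Lists.

Variable T : eqType.

(** The position of [b] determines its predecessor; this is how a vertex on a path gets a single
    parent. *)
Lemma mem_zip_behead (x : T) s a b : uniq s -> (a, b) \in zip (x :: s) s ->
  b \in s /\ a = nth x (x :: s) (index b s).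
Proof.
elim: s x => [|y s IH] x //= /andP[ys us]; rewrite inE => /orP[/eqP[-> ->]|ab].
  by rewrite eqxx.
have [bs ->] := IH y us ab; rewrite bs orbT; split=> //.
rewrite ifN; last by apply: contraNneq ys => ->.
rewrite -[RHS]/(nth x (y :: s) (index b s)); apply: set_nth_default.
by rewrite /= ltnS ltnW // index_mem.
Qed.

Lemma path_zip_behead (e : rel T) x s :
  path e x s = all (fun p => e p.1 p.2) (zip (x :: s) s).
Proof. by elim: s x => //= y s IH x; rewrite IH. Qed.

Lemma mem_zip_behead1 (x : T) s a b : (a, b) \in zip (x :: s) s -> a \in x :: s.
Proof.
elim: s x => //= y s IH x; rewrite !in_cons => /orP[/eqP[-> _]|/IH]; first by rewrite eqxx.
by rewrite in_cons => ->; rewrite orbT.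
Qed.

Lemma unzip2_zip_behead (x : T) s : unzip2 (zip (x :: s) s) = s.
Proof. by rewrite unzip2_zip //= ltnW. Qed.

Lemma uniq_flatten_map (U : eqType) (f : U -> seq T) s :
  uniq s -> (forall i, i \in s -> uniq (f i)) ->
  (forall i j x, i \in s -> j \in s -> x \in f i -> x \in f j -> i = j) ->
  uniq (flatten (map f s)).
Proof.
elim: s => //= i s IH /andP[i_s us] uf disj; rewrite cat_uniq uf ?mem_head //=.
rewrite IH //; first last.
- by move=> k j x ks js; apply: disj; rewrite inE ?ks ?js orbT.
- by move=> j js; apply: uf; rewrite inE js orbT.
rewrite andbT; apply/hasPn => x /flatten_mapP[j js xj]; apply/negP => xi.
by move: i_s; rewrite (disj i j x) ?js // ?inE ?eqxx ?js ?orbT.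
Qed.

End Lists.

Section Sums.

Variables (R : numDomainType) (T : finType) (F : T -> R).
Local Open Scope ring_scope.

Lemma sum_seq_le_set (s : seq T) (A : {set T}) : uniq s ->
  (forall x, x \in s -> x \in A) -> (forall x, x \in A -> 0 <= F x) ->
  \sum_(x <- s) F x <= \sum_(x in A) F x.
Proof.
move=> us sA F_ge0; rewrite [leLHS]big_uniq //= [leRHS](bigID (mem s) (mem A)) /=.
rewrite [X in _ <= X + _](eq_bigl (mem s)); last first.
  by move=> x; rewrite /= andbC; case xs: (x \in s) => //=; rewrite sA.
by rewrite lerDl; apply: sumr_ge0 => x /andP[xA _]; apply: F_ge0.
Qed.

Lemma sum_set_le_seq (s : seq T) (A : {set T}) :
  (forall x, x \in A -> x \notin s -> F x = 0) -> (forall x, x \in s -> 0 <= F x) ->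
  \sum_(x in A) F x <= \sum_(x <- s) F x.
Proof.
move=> F0 F_ge0.
rewrite (bigID (mem s) (mem A)) /= [X in _ + X]big1 ?addr0; last first.
  by move=> x /andP[xA xs]; apply: F0.
(* Removing repetitions from [s] only drops nonnegative terms. *)
apply: (@le_trans _ _ (\sum_(x <- undup s) F x)).
  rewrite [leRHS]big_uniq ?undup_uniq //= [leRHS](bigID (mem A)) /=.
  rewrite (eq_bigl (fun x => (x \in undup s) && (x \in A))); last first.
    by move=> x; rewrite mem_undup andbC.
  by rewrite lerDl; apply: sumr_ge0 => x /andP[]; rewrite mem_undup => /F_ge0.
elim: s {F0} F_ge0 => //= x s IH F_ge0.
have IH' := IH (fun y ys => F_ge0 y (mem_behead (s := x :: s) ys)).
rewrite big_cons; case: ifP => _; last by rewrite big_cons lerD2l.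
by apply: le_trans IH' _; rewrite lerDr F_ge0 ?mem_head.
Qed.

End Sums.

Lemma nth_flatten_uniform (T : Type) (x0 : T) (h : nat -> nat -> T) p q i k :
  i < q -> k < p ->
  nth x0 (flatten [seq [seq h i k | k <- iota 0 p] | i <- iota 0 q]) (i * p + k) = h i k.
Proof.
move=> lt_i lt_k.
suff H m : nth x0 (flatten [seq [seq h i k | k <- iota 0 p] | i <- iota m q]) (i * p + k) =
    h (m + i) k by apply: (H 0).
elim: q m i lt_i => // q IH m i lt_i /=.
rewrite nth_cat size_map size_iota; case: i lt_i => [|i] lt_i.
  by rewrite mul0n add0n lt_k (nth_map 0) ?size_iota // nth_iota // addn0 add0n.
rewrite ifN; last by rewrite mulSn; lia.
by rewrite (_ : i.+1 * p + k - p = i * p + k) ?IH ?addSnnS // mulSn; lia.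
Qed.

(** * Arcs, lengths and legality of the new instance *)

Section NewGraph.

Variables (directed : bool) (I : vdp_instance).
Let G := vdp_graph I.
Let n := nverts G.
Let p := vdp_num I.
Let N := new_size I.
Hypothesis legal_I : vdp_legal directed I.
Hypothesis p_gt1 : 1 < p.

Definition src (i : 'I_p) : 'I_n := (tnth (vdp_pairs I) i).1.
Definition snk (i : 'I_p) : 'I_n := (tnth (vdp_pairs I) i).2.

Lemma nth_pairs_nat (i : 'I_p) : nth (0, 0) (pairs_nat I) i = (val (src i), val (snk i)).
Proof.
rewrite /pairs_nat (nth_map (src i, snk i)) ?size_tuple //.
by rewrite -tnth_nth.
Qed.

Lemma sourceE (i : 'I_p) : source I i = src i.
Proof. by rewrite /source nth_pairs_nat. Qed.

Lemma sinkE (i : 'I_p) : sink I i = snk i.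
Proof. by rewrite /sink nth_pairs_nat. Qed.

Lemma mem_sources v : (v \in unzip1 (vdp_pairs I)) = [exists i, v == src i].
Proof.
apply/mapP/existsP => [[pr /tnthP[i ->] ->]|[i /eqP ->]]; first by exists i; rewrite eqxx.
by exists (tnth (vdp_pairs I) i) => //; apply: mem_tnth.
Qed.

Lemma nth_unzip1 x0 (i : 'I_p) : nth x0 (unzip1 (vdp_pairs I)) i = src i.
Proof. by rewrite (nth_map (x0, x0)) ?size_tuple // -tnth_nth. Qed.

Lemma nth_unzip2 x0 (i : 'I_p) : nth x0 (unzip2 (vdp_pairs I)) i = snk i.
Proof. by rewrite (nth_map (x0, x0)) ?size_tuple // -tnth_nth. Qed.

Lemma src_inj : injective src.
Proof.
have [_] := legal_I; rewrite cat_uniq => /andP[us _] i j E.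
apply/val_inj/eqP; rewrite -(nth_uniq (src i) _ _ us) ?nth_unzip1 ?E //.
  by rewrite size_map size_tuple; apply: ltn_ord.
by rewrite size_map size_tuple; apply: ltn_ord.
Qed.

Lemma snk_inj : injective snk.
Proof.
have [_] := legal_I; rewrite cat_uniq => /and3P[_ _ us] i j E.
apply/val_inj/eqP; rewrite -(nth_uniq (snk i) _ _ us) ?nth_unzip2 ?E //.
  by rewrite size_map size_tuple; apply: ltn_ord.
by rewrite size_map size_tuple; apply: ltn_ord.
Qed.

Definition i0 : 'I_p := Ordinal (ltnW p_gt1).
Definition i1 : 'I_p := Ordinal p_gt1.

Definition anch (w : 'I_n) : 'I_n := if w == snk i0 then src i1 else src i0.

Lemma anchorE (w : 'I_n) : anchor I w = anch w.
Proof.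
rewrite /anchor -[0]/(val i0) -[1]/(val i1) sinkE !sourceE /anch -val_eqE.
by case: ifP.
Qed.

Lemma anch_src w : exists i, anch w = src i.
Proof. by rewrite /anch; case: ifP => _; [exists i1 | exists i0]. Qed.

Lemma anch_snk i : anch (snk i) != src i.
Proof.
rewrite /anch (inj_eq snk_inj); case: (eqVneq i i0) => [-> | ne]; rewrite (inj_eq src_inj) //.
by rewrite eq_sym.
Qed.

Lemma arcs_betweenE (u v : 'I_n) :
  arcs_between I u v = if (u, v) \in arcs G then [:: (u, v)] else [::].
Proof.
rewrite /arcs_between (eq_filter (a2 := pred1 (u, v))); last by case.
case: ifP => uv; first by rewrite filter_pred1_uniq ?enum_uniq ?mem_enum.
apply/eqP; rewrite -[_ == _]negbK -has_filter; apply/hasPn => e; rewrite mem_enum => eA /=.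
by apply: contraFN uv => /eqP <-.
Qed.

Lemma arcs_between_out v w : ~~ ((v < n) && (w < n)) -> arcs_between I v w = [::].
Proof.
move=> vw; apply/eqP; rewrite -[_ == _]negbK -has_filter; apply/hasPn => -[a b] _ /=.
by apply: contraNN vw => /andP[/eqP <- /eqP <-]; rewrite !ltn_ord.
Qed.

Lemma reach_step_mono : {homo @reach_step I : X Y / X \subset Y}.
Proof.
move=> X Y /subsetP XY; apply/subsetP => v; rewrite !inE => /orP[-> //|/existsP[u /andP[uX uv]]].
by apply/orP; right; apply/existsP; exists u; rewrite XY.
Qed.

Lemma in_reach v : (v \in reach I) =
  [exists i, v == src i] || [exists u in reach I, (u, v) \in arcs G].
Proof.
by rewrite {1}/reach -{1}(fixsetK reach_step_mono) inE mem_sources.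
Qed.

Lemma reach_src i : src i \in reach I.
Proof. by rewrite in_reach; apply/orP; left; apply/existsP; exists i. Qed.

Lemma reach_arc u v : u \in reach I -> (u, v) \in arcs G -> v \in reach I.
Proof.
by move=> uR uv; rewrite in_reach; apply/orP; right; apply/existsP; exists u; rewrite uR.
Qed.

Lemma reach_ind (P : pred 'I_n) : (forall i, P (src i)) ->
  (forall u v, u \in reach I -> P u -> (u, v) \in arcs G -> P v) ->
  forall v, v \in reach I -> P v.
Proof.
move=> P0 PS v; rewrite /reach /fixset.
suff H k : iter k (@reach_step I) set0 \subset [set v in reach I | P v].
  by move=> /(subsetP (H _)); rewrite inE => /andP[].
elim: k => [|k IH] /=; first exact: sub0set.
apply/subsetP => w; rewrite [w \in reach_step _]inE mem_sources => /orP[/existsP[i /eqP ->]|/existsP[u /andP[uk uw]]].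
  by rewrite inE reach_src P0.
have := subsetP IH u uk; rewrite !inE => /andP[uR Pu].
by rewrite (reach_arc uR uw) (PS u).
Qed.

Lemma emb_proof : n <= N.
Proof. exact: leq_trans (leqnSn n) (leq_addr _ _). Qed.

Definition emb (v : 'I_n) : 'I_N := widen_ord emb_proof v.
Definition root : 'I_N := new_root I.

Lemma term_proof (i k : 'I_p) : n.+1 + (i * p + k) < N.
Proof.
rewrite /N /new_size -/n -/p ltn_add2l -mulnn.
apply: (@leq_trans (i.+1 * p)); last by rewrite leq_mul2r ltn_ord orbT.
by rewrite mulSnr ltn_add2l ltn_ord.
Qed.

Definition term (i k : 'I_p) : 'I_N := Ordinal (term_proof i k).

Lemma emb_inj : injective emb.
Proof. by move=> u v /(congr1 val) /= E; apply/val_inj. Qed.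

Lemma emb_lt v : emb v < n.
Proof. exact: (ltn_ord v). Qed.

Lemma emb_neq_root v : emb v != root.
Proof. by rewrite -val_eqE /= neq_ltn (ltn_ord v). Qed.

Lemma emb_neq_term v i k : emb v != term i k.
Proof. by rewrite -val_eqE /=; have := ltn_ord v; rewrite -/n; lia. Qed.

Lemma term_neq_root i k : term i k != root.
Proof. by rewrite -val_eqE /= -/G -/n; lia. Qed.

Lemma term_inj i k i' k' : term i k = term i' k' -> i = i' /\ k = k'.
Proof.
move=> /(congr1 val) /= E; have p_gt0 : 0 < p by lia.
have {}E : i * p + k = i' * p + k' by lia.
have := congr1 (fun x => x %/ p) E; have := congr1 (fun x => x %% p) E.
rewrite !modnMDl !modn_small // !divnMDl // !divn_small // !addn0.
by move=> /val_inj -> /val_inj ->.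
Qed.

Variant vertex_spec : 'I_N -> Prop :=
| IsEmb v : vertex_spec (emb v)
| IsRoot : vertex_spec root
| IsTerm i k : vertex_spec (term i k).

Lemma vertexP v : vertex_spec v.
Proof.
have p_gt0 : 0 < p by lia.
case: (ltngtP v n) => [lt_v|gt_v|eq_v].
- have -> : v = emb (Ordinal lt_v) by apply/val_inj.
  exact: IsEmb.
- have lt_q : v - n.+1 < p * p by have := ltn_ord v; rewrite {2}/N /new_size -/n -/p mulnn; lia.
  have lt_i : (v - n.+1) %/ p < p by rewrite ltn_divLR.
  have -> : v = term (Ordinal lt_i) (Ordinal (ltn_pmod (v - n.+1) p_gt0)).
    by apply/val_inj; rewrite /= -divn_eq subnKC.
  exact: IsTerm.
- have -> : v = root by apply/val_inj.
  exact: IsRoot.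
Qed.

Definition att (i k : 'I_p) : 'I_n := if k < i then src i else snk i.

Lemma nth_attach (i k : 'I_p) : nth 0 (attach I) (i * p + k) = att i k.
Proof.
rewrite /attach (nth_flatten_uniform 0 (fun i k => if k < i then source I i else sink I i)) //.
by rewrite sourceE sinkE /att; case: ifP.
Qed.

Lemma mem_reach_nat (v : 'I_n) : ((v : nat) \in reach_nat I) = (v \in reach I).
Proof. by rewrite mem_map ?mem_enum //; apply: val_inj. Qed.

Lemma mem_sources_nat (v : 'I_n) :
  ((v : nat) \in unzip1 (pairs_nat I)) = [exists i, v == src i].
Proof.
rewrite -mem_sources /unzip1 -map_comp.
have -> : map (fst \o (fun pr : 'I_n * 'I_n => (val pr.1, val pr.2))) (vdp_pairs I) =
    map val (unzip1 (vdp_pairs I)) by rewrite /unzip1 -map_comp.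
by rewrite mem_map //; apply: val_inj.
Qed.

Definition old_arc (u v : 'I_n) : bool :=
  (u \in reach I) && ((u, v) \in arcs G) || (v \notin reach I) && (u == anch v).

Lemma new_arc_emb u v : new_arc I (emb u) (emb v) = old_arc u v.
Proof.
rewrite /new_arc -/G -/n !emb_lt !mem_reach_nat arcs_betweenE anchorE /old_arc.
by case: ((u, v) \in _).
Qed.

Lemma new_arc_to_root v : new_arc I v root = false.
Proof. by rewrite /new_arc /= ltnn eqxx. Qed.

Lemma new_arc_root_emb v : new_arc I root (emb v) = [exists i, v == src i].
Proof. by rewrite /new_arc -/G -/n emb_lt /= ltnn eqxx mem_sources_nat. Qed.

Lemma new_arc_to_term (v : 'I_N) i k : new_arc I v (term i k) = (v == emb (att i k)).
Proof.
rewrite /new_arc -/G -/n ifN; last by rewrite /= -/n; lia.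
rewrite ifN; last by rewrite /= -/G -/n; lia.
by rewrite /= -/G -/n (_ : n.+1 + _ - n.+1 = i * p + k) ?nth_attach ?val_eqE //; lia.
Qed.

Lemma new_arc_term i k (v : 'I_N) : new_arc I (term i k) v = false.
Proof.
case: (vertexP v) => [u||i' k'].
- rewrite /new_arc -/G -/n emb_lt ifN; last by rewrite /= -/n; lia.
  by rewrite [_ == _](negbTE (term_neq_root i k)).
- exact: new_arc_to_root.
- by rewrite new_arc_to_term eq_sym (negbTE (emb_neq_term _ _ _)).
Qed.

Let J := cst_of_vdp directed I.

Lemma in_new_arcs (u v : 'I_N) : ((u, v) \in arcs (cst_graph J)) =
  new_arc I u v || ~~ directed && new_arc I v u.
Proof. by rewrite inE. Qed.

Lemma len_emb u v : len (cst_graph J) (emb u, emb v) =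
  if (u, v) \in arcs G then len G (u, v) else 0%R.
Proof. by rewrite /= ffunE /new_len arcs_betweenE; case: ifP. Qed.

Lemma len_out (u v : 'I_N) : ~~ ((u < n) && (v < n)) -> len (cst_graph J) (u, v) = 0%R.
Proof. by move=> uv; rewrite /= ffunE /new_len arcs_between_out. Qed.

Lemma graph_legal : lgraph_legal directed G.
Proof. by case: legal_I. Qed.

Lemma arc_sym u v : ~~ directed -> (u, v) \in arcs G -> (v, u) \in arcs G.
Proof. by case: graph_legal => _ _ sym /sym H /H []. Qed.

Lemma new_len_ge0 u v : (0 <= len (cst_graph J) (u, v))%R.
Proof.
case uv: ((u < n) && (v < n)); last by rewrite len_out ?uv.
move: uv; case: (vertexP u) => [a||i k]; rewrite ?emb_lt /= ?ltnn //; last by rewrite -/n; lia.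
case: (vertexP v) => [b||i k]; rewrite ?emb_lt /= ?ltnn //; last by rewrite -/n; lia.
rewrite len_emb => _; case: ifP => // ab; case: graph_legal => _ ge0 _; exact: ge0.
Qed.

Lemma new_len_sym u v : ~~ directed ->
  len (cst_graph J) (v, u) = len (cst_graph J) (u, v).
Proof.
move=> und; case uv: ((u < n) && (v < n)); last by rewrite !len_out // ?uv // andbC uv.
move: uv; case: (vertexP u) => [a||i k]; rewrite ?emb_lt /= ?ltnn //; last by rewrite -/n; lia.
case: (vertexP v) => [b||i k]; rewrite ?emb_lt /= ?ltnn //; last by rewrite -/n; lia.
rewrite !len_emb => _; case: graph_legal => _ _ /(_ und) sym.
case: ifP => ba; first by have [-> ->] := sym _ _ ba.
by case: ifP => // ab; have [] := sym _ _ ab; rewrite ba.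
Qed.

(** An unreachable vertex is never hung on itself, since anchors are sources and sources are
    reachable. *)
Lemma old_arc_irrefl v : old_arc v v = false.
Proof.
rewrite /old_arc; case: graph_legal => loopless _ _.
rewrite (negbTE (loopless v)) andbF /=; apply/negP => /andP[vR /eqP E].
by have [i Ei] := anch_src v; move: vR; rewrite E Ei reach_src.
Qed.

Lemma new_legal_graph : lgraph_legal directed (cst_graph J).
Proof.
split=> [u|[u v] _|und u v].
- rewrite in_new_arcs; have -> : new_arc I u u = false; last by rewrite andbF.
  case: (vertexP u) => [v||i k]; first by rewrite new_arc_emb old_arc_irrefl.
    exact: new_arc_to_root.
  exact: new_arc_term.
- exact: new_len_ge0.
- by rewrite !in_new_arcs und /= => H; split; [rewrite orbC|apply: new_len_sym].
Qed.

Lemma connect_root v : connect (arc_rel (arcs (cst_graph J))) root v.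
Proof.
have arcP (u w : 'I_N) : new_arc I u w -> connect (arc_rel (arcs (cst_graph J))) u w.
  by move=> uw; apply: connect1; rewrite [arc_rel _ _ _]in_new_arcs uw.
have cs i : connect (arc_rel (arcs (cst_graph J))) root (emb (src i)).
  by apply: arcP; rewrite new_arc_root_emb; apply/existsP; exists i.
have ce u : connect (arc_rel (arcs (cst_graph J))) root (emb u).
  have [uR|uR] := boolP (u \in reach I).
    move: u uR; apply: reach_ind => // u w uR cu uw.
    by apply: connect_trans cu (arcP _ _ _); rewrite new_arc_emb /old_arc uR uw.
  have [i Ei] := anch_src u; apply: connect_trans (cs i) (arcP _ _ _).
  by rewrite new_arc_emb /old_arc uR Ei eqxx orbT.
case: (vertexP v) => [u||i k]; first exact: ce.
  exact: connect0.
by apply: connect_trans (ce (att i k)) (arcP _ _ _); rewrite new_arc_to_term.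
Qed.

Lemma in_terminals v : (v \in cst_terminals J) = (n < v).
Proof. by rewrite inE. Qed.

Lemma terminalsE : cst_terminals J = [set term ik.1 ik.2 | ik : 'I_p * 'I_p].
Proof.
apply/setP => v; rewrite in_terminals; apply/idP/imsetP => [|[[i k] _ ->]]; last by rewrite /= -/n; lia.
case: (vertexP v) => [u||i k]; last by exists (i, k).
  by rewrite ltnNge ltnW // emb_lt.
by rewrite /= ltnn.
Qed.

Lemma card_terminals : #|cst_terminals J| = p ^ 2.
Proof.
rewrite terminalsE card_imset ?card_prod ?card_ord ?mulnn //.
by move=> [i k] [i' k'] /term_inj [/= -> ->].
Qed.

Lemma new_legal : cst_legal directed J.
Proof.
split.
- exact: new_legal_graph.
- split=> [e _|_ u v _]; rewrite !ffunE //; exact: ltnW.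
- have [dir|und] := boolP directed; first exact: connect_root.
  move=> u v; apply: connect_trans (connect_root v).
  rewrite sym_connect_sym; first exact: connect_root.
  by move=> a b; rewrite [LHS]in_new_arcs [RHS]in_new_arcs und orbC.
- by rewrite card_terminals -mulnn; move: p_gt1; nia.
- by rewrite in_terminals /= ltnn.
Qed.

End NewGraph.

(** * From trees to paths *)

Lemma card_ord_lt p a : a <= p -> #|[set k : 'I_p | k < a]| = a.
Proof.
move=> le_a; rewrite -sum1_card (eq_bigl (fun k : 'I_p => k < a)); last by move=> k; rewrite inE.
by rewrite (big_ord_narrow le_a) sum_nat_const card_ord muln1.
Qed.

Section FromTree.

Variables (directed : bool) (I : vdp_instance).
Let G := vdp_graph I.
Let n := nverts G.
Let p := vdp_num I.
Let N := new_size I.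
Hypothesis legal_I : vdp_legal directed I.
Hypothesis p_gt1 : 1 < p.
Let J := cst_of_vdp directed I.
Let r : 'I_N := root I.

Variable S : cst_candidate J.
Hypothesis feas_S : cst_feasible S.

Let T : {set 'I_N} := cst_terminals J.
Let E := arc_rel S.

Lemma S_tree : out_tree r S.
Proof. by case: feas_S. Qed.

Lemma S_arc (u v : 'I_N) : (u, v) \in S -> new_arc I u v || ~~ directed && new_arc I v u.
Proof. by case: feas_S => /subsetP SA _ _ _ /SA; rewrite in_new_arcs. Qed.

Lemma root_arc v : (r, v) \in S -> exists i, v = emb (src i).
Proof.
move=> /S_arc; rewrite new_arc_to_root andbF orbF.
case: (vertexP p_gt1 v) => [u||i k]; rewrite ?new_arc_root_emb ?new_arc_to_root ?(new_arc_to_term p_gt1) //.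
  by case/existsP => i /eqP ->; exists i.
by rewrite eq_sym (negbTE (emb_neq_root _)).
Qed.

Lemma term_in_T i k : term i k \in T.
Proof. by rewrite /T in_terminals /= ltn_addr. Qed.

Lemma term_spanned i k : term i k \in spanned r S.
Proof. by case: feas_S => _ _ /subsetP sub _; apply/sub/term_in_T. Qed.

Lemma to_term_arc a i k : (a, term i k) \in S -> a = emb (att i k).
Proof.
by move=> /S_arc; rewrite (new_arc_to_term p_gt1) (new_arc_term p_gt1) andbF orbF => /eqP.
Qed.

Lemma att_arc i k : (emb (att i k), term i k) \in S.
Proof.
have [a aS] := out_tree_last_arc S_tree (term_spanned i k) (term_neq_root p_gt1 i k).
by rewrite -(to_term_arc aS).
Qed.

Definition desc (v : 'I_N) : {set 'I_N} := [set t in T | connect E v t].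

Lemma card_desc (i : 'I_p) : (r, emb (src i)) \in S -> #|desc (emb (src i))| <= p.
Proof. by case: feas_S => _ _ _ cap /cap; rewrite ffunE. Qed.

Lemma in_branch v : v \in spanned r S -> v != r ->
  exists i, (r, emb (src i)) \in S /\ connect E (emb (src i)) v.
Proof.
move=> vS vr; have [u ru uv] := out_tree_in_branch S_tree vS vr.
by have [i Ei] := root_arc ru; exists i; rewrite -Ei.
Qed.

(** The children of the root are sources, so every terminal is counted in at least one branch. *)
Lemma terminals_le_branches :
  p ^ 2 <= \sum_(i < p | (r, emb (src i)) \in S) #|desc (emb (src i))|.
Proof.
rewrite -(card_terminals directed p_gt1) -sum1_card.
under [leqRHS]eq_bigr do rewrite -sum1_card big_mkcond /=.
rewrite exchange_big /= [leqRHS](bigID (mem T)) /= -[leqLHS]addn0 leq_add //.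
apply: leq_sum => t tT.
have [||i [ri ti]] := @in_branch t.
- by case: feas_S => _ _ /subsetP sub _; apply: sub.
- by apply: contraTneq tT => ->; rewrite (in_terminals (directed := directed)) /= ltnn.
by rewrite (bigD1 i) //= inE tT ti.
Qed.

(** Without branch [i], the other p - 1 branches would hold at most (p - 1) p < p^2 terminals. *)
Lemma branch_arc (i : 'I_p) : (r, emb (src i)) \in S.
Proof.
have H := terminals_le_branches; apply/negPn/negP => ri.
have : \sum_(j < p | (r, emb (src j)) \in S) #|desc (emb (src j))| <= \sum_(j < p | j != i) p.
  rewrite big_mkcond [leqRHS]big_mkcond /=; apply: leq_sum => j _.
  case: ifP => rj //; rewrite ifT ?card_desc //.
  by apply: contraNneq ri => <-.
rewrite sum_nat_const cardC1 card_ord; move: H p_gt1; rewrite -mulnn; nia.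
Qed.

Lemma card_desc_eq (i : 'I_p) : p <= #|desc (emb (src i))|.
Proof.
have := terminals_le_branches; rewrite (bigD1 i) ?branch_arc //=.
have : \sum_(j < p | ((r, emb (src j)) \in S) && (j != i)) #|desc (emb (src j))| <=
    \sum_(j < p | j != i) p.
  rewrite big_mkcond [leqRHS]big_mkcond /=; apply: leq_sum => j _.
  by rewrite branch_arc /=; case: ifP => // _; rewrite card_desc ?branch_arc.
rewrite sum_nat_const cardC1 card_ord -subn1 mulnBl mul1n -mulnn.
have le_pp : p <= p * p by rewrite leq_pmulr // ltnW.
move=> le_s le_T; rewrite -(leq_add2r (p * p - p)) subnKC //.
by apply: leq_trans le_T _; rewrite leq_add2l.
Qed.

Lemma branch_inj i j v : connect E (emb (src i)) v -> connect E (emb (src j)) v -> i = j.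
Proof.
move=> iv jv; apply: (src_inj legal_I); apply: (@emb_inj I).
exact: (out_tree_branch S_tree (branch_arc i) (branch_arc j) iv jv).
Qed.

Lemma snk_spanned i : emb (snk i) \in spanned r S.
(* Terminal [term i i] hangs on the sink, because i < i fails; so every sink carries a terminal. *)
Proof. by have := spanned_tail r (att_arc i i); rewrite /att ltnn. Qed.

Lemma snk_term (i k : 'I_p) : i <= k -> (emb (snk i), term i k) \in S.
Proof. by move=> ik; have := att_arc i k; rewrite /att ltnNge ik. Qed.

(* With [sigma i] the branch of sink [i]: every branch [j] is full but has only
   [j < p] terminals on its own source, so [sigma] is onto, hence bijective, and
   [p <= sigma i + (p - i)], that is [i <= sigma i], leaves only the identity. *)
Lemma snk_branch i : connect E (emb (src i)) (emb (snk i)).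
Proof.
have /fin_all_exists[sigma sP] : forall i, exists j, connect E (emb (src j)) (emb (snk i)).
  by move=> k; have [j [_ ?]] := in_branch (snk_spanned k) (emb_neq_root _); exists j.
(* A terminal of branch j hangs either on source j itself or on a sink that lies in branch j. *)
have descP j t : t \in desc (emb (src j)) -> exists a b,
    t = term a b /\ (if b < a then a = j else sigma a = j).
  rewrite inE /T (terminalsE directed p_gt1) => /andP[/imsetP[[a b] _ ->] /= jt].
  exists a, b; split=> //; case: ifP => ba.
    apply: branch_inj jt; apply: connect1.
    by have := att_arc a b; rewrite /att ba.
  apply: branch_inj jt; apply: connect_trans (sP a) (connect1 _).
  by apply: snk_term; rewrite leqNgt ba.
have card_lt (a : 'I_p) : #|term a @: [set k : 'I_p | k < a]| <= a.
  by apply: leq_trans (leq_imset_card _ _) _; rewrite card_ord_lt // ltnW.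
have card_ge (a : 'I_p) : #|term a @: [set k : 'I_p | a <= k]| <= p - a.
  apply: leq_trans (leq_imset_card _ _) _.
  have -> : [set k : 'I_p | a <= k] = ~: [set k : 'I_p | k < a].
    by apply/setP => k; rewrite !inE -leqNgt.
  by rewrite -[X in _ <= X - _]card_ord -(cardsC [set k : 'I_p | k < a]) card_ord_lt ?addKn // ltnW.
have surj j : exists i, sigma i = j.
  have [/existsP[k /eqP <-]|] := boolP [exists k, sigma k == j]; first by exists k.
  rewrite negb_exists => /forallP no.
  (* A branch without a sink could hold only the j terminals on its own source, and j < p. *)
  have : #|desc (emb (src j))| <= j.
    apply: leq_trans (card_lt j); apply/subset_leq_card/subsetP => t /descP[a [b [-> ]]].
    case: ifP => [ba <-|_ Ea]; first by apply/imsetP; exists b; rewrite ?inE.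
    by have := no a; rewrite Ea eqxx.
  by have := card_desc_eq j; have := ltn_ord j; rewrite -/p; lia.
(* A right inverse of [sigma] is injective, hence bijective on a finite type, which makes [sigma]
   its inverse. *)
have inj : injective sigma.
  have /fin_all_exists[g gK] := surj.
  have /injF_bij g_bij : injective g by apply: can_inj gK.
  exact: can_inj ((bij_can_sym g_bij sigma).2 gK).
have le_sigma (k : 'I_p) : k <= sigma k.
  have : #|desc (emb (src (sigma k)))| <= sigma k + (p - k).
    apply: (@leq_trans #|term (sigma k) @: [set b : 'I_p | b < sigma k] :|:
                         term k @: [set b : 'I_p | k <= b]|).
      apply/subset_leq_card/subsetP => t /descP[a [b [-> ]]]; rewrite inE.
      case: ifP => [ba <-|ba /inj <-]; apply/orP; [left|right]; apply/imsetP; exists b;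
        by rewrite // inE // leqNgt ba.
    apply: leq_trans (leq_card_setU _ _) _; exact: leq_add.
  by have := card_desc_eq (sigma k); have := ltn_ord k; rewrite -/p; lia.
(* A permutation preserves the sum of the indices, so the termwise inequality [le_sigma] is an
   equality everywhere. *)
have : \sum_(k < p) k == \sum_(k < p) sigma k.
  by rewrite (reindex_inj inj).
rewrite (leqif_sum (fun k _ => leqif_eq (le_sigma k))) => /forallP /(_ i) /eqP/val_inj E_i.
by have := sP i; rewrite -E_i.
Qed.

(** A hanging edge run through backwards would start at an unreachable vertex; a kept edge run
    through backwards is an arc of the graph by symmetry. *)
Lemma in_reach_arc u v : u \in reach I -> (emb u, emb v) \in S ->
  (u, v) \in arcs G \/ (v \notin reach I /\ u = anch p_gt1 v).
Proof.
move=> uR /S_arc; rewrite !(new_arc_emb p_gt1) /old_arc uR /=.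
case/orP => [/orP[->|/andP[? /eqP ?]]|/andP[und]]; [by left|by right|].
rewrite orbF => /andP[_ vu]; left; exact: (arc_sym legal_I und vu).
Qed.

Lemma branch_uniq i w : path E (emb (src i)) w -> uniq (emb (src i) :: w).
Proof. by move=> pw; apply: (out_tree_path_uniq S_tree (spanned_head _ (branch_arc i)) pw). Qed.

(** No tree arc enters the root, and the only neighbour of a terminal is its attachment point, so
    leaving a terminal would repeat the vertex from which it was entered. *)
Lemma emb_path a t w : path E (emb a) w -> uniq (emb a :: w) -> last (emb a) w = emb t ->
  exists w', w = map (@emb I) w'.
Proof.
elim: w a => [|y w IH] a /=; first by exists [::].
move=> /andP[ay pw] /andP[a_w uw] lw.
case: (vertexP p_gt1 y) ay pw lw a_w uw => [b||j k] ay pw lw a_w uw.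
- by have [w' ->] := IH b pw uw lw; exists (b :: w').
- by case/negP: (out_tree_root S_tree (emb a)).
- case: w {IH} pw lw a_w uw => [|z w] /=.
    by move=> _ /eqP; rewrite eq_sym (negbTE (emb_neq_term p_gt1 _ _ _)).
  move=> /andP[jz _] _ a_w _; move: (to_term_arc ay) => a_t.
  have := S_arc jz; rewrite (new_arc_term p_gt1) /= => /andP[_].
  by rewrite (new_arc_to_term p_gt1) -a_t => /eqP z_a; rewrite z_a !inE eqxx orbT in a_w.
Qed.

Lemma emb_not_src b c j : (emb b, emb c) \in S -> c != src j.
Proof.
move=> bc; apply/eqP => Ec; have := out_tree_parent S_tree (branch_arc j).
by rewrite -Ec => /(_ _ bc) /eqP; rewrite eq_sym (negbTE (emb_neq_root _)).
Qed.

(** Suppose that the path enters a hung vertex b. It comes from the anchor of b, a source in branch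
    i, hence s_i itself. If the path ends at b, then the sink of pair i hangs on its own source,
    which [anch_snk] excludes. Otherwise the only way on from b leads back to that anchor, a source,
    whose parent is already the root. *)
Lemma old_path i a w : a \in reach I -> connect E (emb (src i)) (emb a) ->
  path E (emb a) (map (@emb I) w) -> last a w = snk i ->
  path (arc_rel (arcs G)) a w.
Proof.
elim: w a => //= b w IH a aR ca /andP[ay pw] lw.
have cb : connect E (emb (src i)) (emb b) by apply: connect_trans ca (connect1 ay).
have [ab|[bR a_b]] := in_reach_arc aR ay.
  by apply/andP; split=> //; apply: IH => //; apply: reach_arc aR ab.
have [j a_j] := anch_src p_gt1 b.
have j_i : j = i.
  by apply: (branch_inj (v := emb b)) cb; apply: connect1; rewrite -a_j -a_b.
case: w {IH} pw lw => [|c w] /=.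
  by move=> _ b_i; have := anch_snk legal_I p_gt1 i; rewrite -b_i a_j j_i eqxx.
move=> /andP[bc _] _; have := S_arc bc.
rewrite !(new_arc_emb p_gt1) /old_arc (negbTE bR) /=.
case/orP => [/andP[_ /eqP b_c]|/andP[und]].
  by have [k Ek] := anch_src p_gt1 c; move: bR; rewrite b_c Ek reach_src.
case/orP => [/andP[cR cb']|/eqP c_b]; first by rewrite (reach_arc cR cb') in bR.
by have := emb_not_src j bc; rewrite c_b a_j eqxx.
Qed.

Lemma branch_path i : exists w, [/\ path E (emb (src i)) (map (@emb I) w),
  path (arc_rel (arcs G)) (src i) w, last (src i) w = snk i & uniq (src i :: w)].
Proof.
have /connectP[w0 pw0 lw0] := snk_branch i; have uw0 := branch_uniq pw0.
have [w w0E] := emb_path pw0 uw0 (esym lw0); rewrite {w0}w0E in pw0 lw0 uw0 *.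
have lw : last (src i) w = snk i by apply: (@emb_inj I); rewrite lw0 last_map.
exists w; split=> //; first by apply: old_path lw; rewrite ?reach_src.
by move: uw0; rewrite -map_cons map_inj_uniq //; apply: emb_inj.
Qed.

Lemma parent_step_arc a b w : (emb a, emb b) \in S ->
  parent_step I (arcs_nat S) (val b :: w) = [:: val a, val b & w].
Proof.
move=> ab; rewrite /parent_step -/G -/n /=.
have : (val a, val b) \in [seq e <- arcs_nat S | (e.2 == val b) && (e.1 < n)].
  rewrite mem_filter eqxx /= ltn_ord /=; apply/mapP.
  by exists (emb a, emb b); rewrite ?mem_enum.
case Es : [seq _ <- _ | _] => [//|[x y] s] _; congr (_ :: _) => /=.
have : (x, y) \in [seq e <- arcs_nat S | (e.2 == val b) && (e.1 < n)].
  by rewrite Es mem_head.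
rewrite mem_filter /= => /andP[/andP[/eqP -> lt_x] /mapP[[u v]]].
rewrite mem_enum /= => uv [-> v_b].
have Ev : v = emb b by apply/val_inj/esym; exact: v_b.
by rewrite Ev in uv; rewrite (out_tree_parent S_tree uv ab).
Qed.

(** The parent of a source is the root, whose number n fails the test [a.1 < n]. *)
Lemma parent_step_src (i : 'I_p) w :
  parent_step I (arcs_nat S) (val (src i) :: w) = val (src i) :: w.
Proof.
rewrite /parent_step -/G -/n /=; case Es : [seq _ <- _ | _] => [//|[x y] s].
have : (x, y) \in [seq e <- arcs_nat S | (e.2 == val (src i)) && (e.1 < n)].
  by rewrite Es mem_head.
rewrite mem_filter /= => /andP[/andP[/eqP -> lt_x] /mapP[[u v]]].
rewrite mem_enum /= => uv [x_u v_i].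
have Ev : v = emb (src i) by apply/val_inj/esym; exact: v_i.
rewrite Ev in uv; have Eu := out_tree_parent S_tree uv (branch_arc i).
by move: lt_x; rewrite x_u Eu /= ltnn.
Qed.

Lemma walk_backP i w : path E (emb (src i)) (map (@emb I) w) -> last (src i) w = snk i ->
  uniq (src i :: w) -> walk_back I (arcs_nat S) (val (snk i)) = map val (src i :: w).
Proof.
move=> pw lw uw.
have H a : path E (emb a) (map (@emb I) w) ->
    iter (size w) (parent_step I (arcs_nat S)) [:: val (last a w)] = map val (a :: w).
  elim: (w) a => //= b w' IH a /andP[ab pw'].
  by rewrite IH //= (parent_step_arc _ ab).
have le_w : size w <= n.
  by have := max_card (mem (src i :: w)); rewrite (card_uniqP uw) card_ord => /ltnW.
(* The first [size w] rounds climb to the source; the others leave the walk unchanged. *)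
have -> : walk_back I (arcs_nat S) (val (snk i)) = iter (n - size w)
    (parent_step I (arcs_nat S)) (iter (size w) (parent_step I (arcs_nat S)) [:: val (snk i)]).
  by rewrite -iterD subnK.
rewrite -lw H //.
elim: (n - size w) => //= k ->; exact: parent_step_src.
Qed.

Lemma vdp_of_cst_path i : exists w, [/\ tnth (vdp_of_cst S) i = src i :: w,
  path E (emb (src i)) (map (@emb I) w),
  path (arc_rel (arcs G)) (src i) w, last (src i) w = snk i & uniq (src i :: w)].
Proof.
have [w [pS pw lw uw]] := branch_path i; exists w; split=> //.
rewrite tnth_map -/(snk i) (walk_backP pS lw uw).
by rewrite (map_pK (g := val)) //; apply: valK.
Qed.

Lemma vdp_of_cst_desc i v : v \in tnth (vdp_of_cst S) i -> connect E (emb (src i)) (emb v).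
Proof.
have [w [-> pS _ _ _]] := vdp_of_cst_path i => vw.
by apply: (path_connect pS); rewrite -map_cons map_f.
Qed.

Lemma vdp_of_cst_disj i j v :
  v \in tnth (vdp_of_cst S) i -> v \in tnth (vdp_of_cst S) j -> i = j.
Proof. by move=> /vdp_of_cst_desc vi /vdp_of_cst_desc; apply: branch_inj. Qed.

Lemma vdp_of_cst_feasible : vdp_feasible (vdp_of_cst S).
Proof.
split=> [i|i j ij].
  by have [w [-> _ pw lw uw]] := vdp_of_cst_path i; exists w.
rewrite disjoint_has; apply/hasPn => v vi; apply/negP => vj.
by move: ij; rewrite (vdp_of_cst_disj vi vj) eqxx.
Qed.

(** The path arcs are distinct arcs of the tree: within a path they differ in their heads, and
    different paths are disjoint. The remaining tree arcs have nonnegative length. *)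
Lemma vdp_of_cst_cost : (vdp_cost (vdp_of_cst S) <= cst_cost S)%R.
Proof.
pose L i := zip (tnth (vdp_of_cst S) i) (behead (tnth (vdp_of_cst S) i)).
pose f (e : 'I_n * 'I_n) : 'I_N * 'I_N := (emb e.1, emb e.2).
have LP i e : e \in L i -> (f e \in S) && (e \in arcs G).
  rewrite /L; have [w [-> pS pw _ _]] := vdp_of_cst_path i.
  move: pS pw; rewrite !path_zip_behead => /allP H /allP H'; case: e => a b ew.
  apply/andP; split; last exact: (H' _ ew).
  apply: (H (f (a, b))).
  have <- x : map f (zip (x :: w) w) = zip (emb x :: map (@emb I) w) (map (@emb I) w).
    by elim: (w) x => //= y w' IH x; rewrite IH.
  exact: map_f.
have L_last i : unzip2 (L i) = behead (tnth (vdp_of_cst S) i).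
  by rewrite /L; have [w [-> _ _ _ _]] := vdp_of_cst_path i; apply: unzip2_zip_behead.
have uL : uniq (flatten [seq L i | i <- enum 'I_p]).
  apply: uniq_flatten_map => [|i _|i j e _ _ ei ej]; first exact: enum_uniq.
    apply: (@map_uniq _ _ snd); rewrite -/(unzip2 _) L_last.
    by have [w [-> _ _ _ /andP[]]] := vdp_of_cst_path i.
  have mem2 k : e \in L k -> e.2 \in tnth (vdp_of_cst S) k.
    by move=> ek; apply: mem_behead; rewrite -L_last; apply: map_f.
  by apply: (vdp_of_cst_disj (mem2 i ei) (mem2 j ej)).
have -> : vdp_cost (vdp_of_cst S) =
    (\sum_(e <- map f (flatten [seq L i | i <- enum 'I_p])) len (cst_graph J) e)%R.
  rewrite big_map big_flatten big_map big_enum /=; apply: eq_bigr => i _.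
  apply: eq_big_seq => -[a b] /LP /andP[_ ab].
  by rewrite (len_emb directed) ab.
apply: sum_seq_le_set.
- rewrite map_inj_uniq // => -[a b] [a' b'] Ef; congr (_, _); apply: (@emb_inj I).
    exact: (congr1 fst Ef).
  exact: (congr1 snd Ef).
- by move=> e' /mapP[e /flatten_mapP[i _ /LP /andP[? _]] ->].
- by move=> [u v] _; apply: (new_len_ge0 legal_I p_gt1).
Qed.

End FromTree.

(** * From paths to trees *)

Section FromPaths.

Variables (directed : bool) (I : vdp_instance).
Let G := vdp_graph I.
Let n := nverts G.
Let p := vdp_num I.
Let N := new_size I.
Hypothesis legal_I : vdp_legal directed I.
Hypothesis p_gt1 : 1 < p.
Let J := cst_of_vdp directed I.
Let r : 'I_N := root I.

Variable mu : vdp_candidate I.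
Hypothesis feas_mu : vdp_feasible mu.

Definition path_arcs : seq ('I_N * 'I_N) :=
  [seq (emb e.1, emb e.2) | e <- flatten [seq zip w (behead w) | w : seq _ <- mu]].

Definition cst_of_paths : {set 'I_N * 'I_N} :=
  [set (r, emb (src i)) | i : 'I_p] :|: [set e in path_arcs]
  :|: [set (emb (att ik.1 ik.2), term ik.1 ik.2) | ik : 'I_p * 'I_p].

Let S : cst_candidate J := cst_of_paths.

Lemma mu_path i : exists w, [/\ tnth mu i = src i :: w,
  path (arc_rel (arcs G)) (src i) w, last (src i) w = snk i & uniq (src i :: w)].
Proof.
case: feas_mu => /(_ i) [w [E pw lw uw]] _.
by exists w; rewrite -E.
Qed.

Lemma mu_disj i j v : v \in tnth mu i -> v \in tnth mu j -> i = j.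
Proof.
move=> vi vj; apply/eqP; apply: contraT => /(proj2 feas_mu).
by rewrite disjoint_has => /hasPn /(_ v vi) /negP.
Qed.

Variant tree_arc_spec : 'I_N -> 'I_N -> Prop :=
| RootArc i : tree_arc_spec r (emb (src i))
| PathArc i a b of (a, b) \in zip (tnth mu i) (behead (tnth mu i)) :
    tree_arc_spec (emb a) (emb b)
| TermArc i k : tree_arc_spec (emb (att i k)) (term i k).

Lemma tree_arcP u v : (u, v) \in S <-> tree_arc_spec u v.
Proof.
rewrite !inE; split.
- case/orP => [/orP[/imsetP[i _ [-> ->]]|]|/imsetP[[i k] _ [-> ->]]].
  + exact: RootArc.
  + case/mapP => -[a b] /flatten_mapP[w /tnthP[i ->] ab] [-> ->].
    exact: PathArc ab.
  + exact: TermArc.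
- case=> [i|i a b ab|i k].
  + by rewrite imset_f.
  + apply/orP; left; apply/orP; right; apply/mapP; exists (a, b) => //.
    by apply/flatten_mapP; exists (tnth mu i) => //; apply: mem_tnth.
  + by apply/orP; right; apply/imsetP; exists (i, k).
Qed.

Lemma src_mu i : src i \in tnth mu i.
Proof. by have [w [-> _ _ _]] := mu_path i; apply: mem_head. Qed.

Lemma snk_mu i : snk i \in tnth mu i.
Proof. by have [w [-> _ <- _]] := mu_path i; apply: mem_last. Qed.

Lemma att_mu i k : att i k \in tnth mu i.
Proof. by rewrite /att; case: ifP => _; [apply: src_mu|apply: snk_mu]. Qed.

Lemma zip_mu i a b : (a, b) \in zip (tnth mu i) (behead (tnth mu i)) ->
  [/\ a \in tnth mu i, b \in tnth mu i, b != src i & (a, b) \in arcs G].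
Proof.
have [w [-> pw _ uw]] := mu_path i; rewrite [behead _]/= => ab.
have /andP[src_w uw'] := uw; have [bw _] := mem_zip_behead uw' ab.
split; first exact: mem_zip_behead1 ab.
- by rewrite inE bw orbT.
- by apply: contraNneq src_w => <-.
- by move: pw; rewrite path_zip_behead => /allP /(_ _ ab).
Qed.

Lemma mu_reach i a : a \in tnth mu i -> a \in reach I.
Proof.
have [w [-> pw _ _]] := mu_path i; rewrite inE => /orP[/eqP ->|]; first exact: reach_src.
elim: w (src i) (reach_src i) pw => //= b w IH x xR /andP[xb pw].
have bR := reach_arc xR xb; rewrite inE => /orP[/eqP -> //|]; exact: IH bR pw.
Qed.

Lemma tree_sub_arcs : S \subset arcs (cst_graph J).
Proof.
apply/subsetP => -[u v] /tree_arcP uv; rewrite in_new_arcs; apply/orP; left.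
case: uv => [i|i a b /zip_mu[aM _ _ ab]|i k].
- by rewrite new_arc_root_emb; apply/existsP; exists i.
- by rewrite (new_arc_emb p_gt1) /old_arc (mu_reach aM) ab.
- by rewrite (new_arc_to_term p_gt1).
Qed.

(** The head decides the kind of the arc: a source, a later vertex of a path, or a terminal.
    Disjointness then fixes the path, and the position on it fixes the tail. *)
Lemma tree_parent a b v : (a, v) \in S -> (b, v) \in S -> a = b.
Proof.
move=> /tree_arcP av; case: av => [i|i x y xy|i k] /tree_arcP bv.
- move Ev: (emb (src i)) bv => v' bv; case: bv Ev => // [j x y /zip_mu[_ yM y_src _]|j k].
    move/(@emb_inj I) => Ey; move: yM y_src; rewrite -Ey => yM.
    by rewrite (mu_disj (src_mu i) yM) eqxx.
  by move/eqP; rewrite (negbTE (emb_neq_term p_gt1 _ _ _)).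
- have [_ yM y_src _] := zip_mu xy.
  move Ev: (emb y) bv => v' bv; case: bv Ev => [j|j x' y' xy'|j k].
  + move/(@emb_inj I) => Ey; move: y_src yM; rewrite Ey => y_src yM.
    by rewrite (mu_disj (src_mu j) yM) eqxx in y_src.
  + move/(@emb_inj I) => Ey; subst y'; have [_ yM' _ _] := zip_mu xy'.
    have Eij := mu_disj yM yM'; subst j; congr emb; move: xy xy'.
    have [w [-> _ _ /andP[_ uw]]] := mu_path i; rewrite [behead _]/= => xy xy'.
    by have [_ ->] := mem_zip_behead uw xy; have [_ ->] := mem_zip_behead uw xy'.
  + by move/eqP; rewrite (negbTE (emb_neq_term p_gt1 _ _ _)).
- move Ev: (term i k) bv => v' bv; case: bv Ev => [j|j x' y' xy'|j k'].
  + by move/eqP; rewrite eq_sym (negbTE (emb_neq_term p_gt1 _ _ _)).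
  + by move/eqP; rewrite eq_sym (negbTE (emb_neq_term p_gt1 _ _ _)).
  + by case/(term_inj p_gt1) => -> ->.
Qed.

Lemma tree_root a : (a, r) \notin S.
Proof.
apply/negP => /tree_arcP ar; move Er: r ar => v ar; case: ar Er => [i|i x y _|i k] /eqP.
- by rewrite eq_sym (negbTE (emb_neq_root _)).
- by rewrite eq_sym (negbTE (emb_neq_root _)).
- by rewrite eq_sym (negbTE (term_neq_root p_gt1 _ _)).
Qed.

Lemma connect_mu i a : a \in tnth mu i -> connect (arc_rel S) r (emb a).
Proof.
have cs : connect (arc_rel S) r (emb (src i)) by apply/connect1/tree_arcP/RootArc.
have H x y : (x, y) \in zip (tnth mu i) (behead (tnth mu i)) -> (emb x, emb y) \in S.
  by move=> xy; apply/tree_arcP/(PathArc xy).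
move: H; have [w [-> _ _ _]] := mu_path i; rewrite [behead _]/= => H.
elim: w (src i) cs H => [|y w IH] x cx H.
  by rewrite inE => /eqP ->.
rewrite inE => /orP[/eqP -> //|]; apply: IH.
  by apply: connect_trans cx (connect1 (H x y _)); rewrite /= mem_head.
by move=> x' y' xy'; apply: H; rewrite /= inE xy' orbT.
Qed.

Lemma tree_out_tree : out_tree r S.
Proof.
apply: out_tree_intro; [exact: tree_parent|exact: tree_root|].
have arc_conn u v : (u, v) \in S -> connect (arc_rel S) r u /\ connect (arc_rel S) r v.
  move=> uv; have cu : connect (arc_rel S) r u.
    have /tree_arcP := uv; case=> [i|i a b /zip_mu[aM _ _ _]|i k].
    - exact: connect0.
    - exact: connect_mu aM.
    - exact: connect_mu (att_mu i k).
  by split=> //; apply: connect_trans cu (connect1 uv).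
move=> v; rewrite !inE => /orP[/orP[/eqP ->|/imsetP[[a b] ab ->]]|/imsetP[[a b] ab ->]].
- exact: connect0.
- by have [] := arc_conn _ _ ab.
- by have [] := arc_conn _ _ ab.
Qed.

(** The vertices of the branch of pair i. This set is closed under the arcs of the tree, so the
    subtree below any arc contains terminals of one pair only, at most p of them. *)
Definition labelled (i : 'I_p) (v : 'I_N) : Prop :=
  (exists2 a, a \in tnth mu i & v = emb a) \/ (exists k, v = term i k).

Lemma tree_arc_labelled u v : (u, v) \in S -> exists i, labelled i v.
Proof.
move=> /tree_arcP[i|i a b /zip_mu[_ bM _ _]|i k]; exists i.
- by left; exists (src i) => //; apply: src_mu.
- by left; exists b.
- by right; exists k.
Qed.

Lemma labelled_step i u v : labelled i u -> (u, v) \in S -> labelled i v.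
Proof.
move=> lab_u /tree_arcP uv; case: uv lab_u => [j|j a b ab|j k].
- case=> [[a _ /eqP]|[k /eqP]].
    by rewrite eq_sym (negbTE (emb_neq_root _)).
  by rewrite eq_sym (negbTE (term_neq_root p_gt1 _ _)).
- have [aM bM _ _] := zip_mu ab; case=> [[a' aM' /(@emb_inj I) Ea]|[k /eqP]].
    by rewrite -Ea in aM'; rewrite (mu_disj aM' aM); left; exists b.
  by rewrite (negbTE (emb_neq_term p_gt1 _ _ _)).
- case=> [[a' aM' /(@emb_inj I) Ea]|[k' /eqP]].
    by rewrite -Ea in aM'; rewrite (mu_disj aM' (att_mu j k)); right; exists k.
  by rewrite (negbTE (emb_neq_term p_gt1 _ _ _)).
Qed.

Lemma labelled_connect i u v : labelled i u -> connect (arc_rel S) u v -> labelled i v.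
Proof.
move=> lab_u /connectP[w pw ->]; elim: w u lab_u pw => //= y w IH u lab_u /andP[uy pw].
exact: IH (labelled_step lab_u uy) pw.
Qed.

Lemma cst_of_paths_feasible : cst_feasible S.
Proof.
split; [exact: tree_sub_arcs|exact: tree_out_tree| |].
  apply/subsetP => t; rewrite (terminalsE directed p_gt1) => /imsetP[[i k] _ ->] /=.
  by apply: (@spanned_head _ _ _ (emb (att i k))); apply/tree_arcP/TermArc.
move=> u v /tree_arc_labelled[i lab_v]; rewrite ffunE -/p.
apply: (@leq_trans #|term i @: setT|); last first.
  by apply: leq_trans (leq_imset_card _ _) _; rewrite cardsT card_ord.
apply/subset_leq_card/subsetP => t; rewrite inE => /andP[tT vt].
have := labelled_connect lab_v vt; case=> [[a _ Et]|[k ->]]; last by rewrite imset_f ?inE.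
by move: tT; rewrite Et (in_terminals (directed := directed)) ltnNge ltnW // emb_lt.
Qed.

(** Arcs leaving the root or entering a terminal have length 0, and all others come from the
    paths. *)
Lemma cst_of_paths_cost : (cst_cost S <= vdp_cost mu)%R.
Proof.
have -> : vdp_cost mu = (\sum_(e <- path_arcs) len (cst_graph J) e)%R.
  rewrite big_map big_flatten big_map big_tuple /=; apply: eq_bigr => i _.
  by apply: eq_big_seq => -[a b] /zip_mu[_ _ _ ab]; rewrite (len_emb directed) ab.
apply: sum_set_le_seq => [[u v] /tree_arcP uv|[u v] _]; last exact: new_len_ge0.
case: uv => [i|i a b ab|i k].
- by move=> _; apply: (len_out directed); rewrite /= ltnn.
- case/negP; apply/mapP; exists (a, b) => //; apply/flatten_mapP.
  by exists (tnth mu i) => //; apply: mem_tnth.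
- move=> _; apply: (len_out directed); rewrite negb_and orbC -leqNgt.
  by rewrite /= ltnW // ltnS leq_addr.
Qed.

End FromPaths.

(** * Equivalence of feasibility and transfer of optimality *)

Lemma cst_of_vdp_feasible directed I : vdp_legal directed I -> 1 < vdp_num I ->
  feasible (P := ml_vdisj_path directed) I <->
  feasible (P := ml_cap_steiner_tree directed) (cst_of_vdp directed I).
Proof.
move=> legal_I p_gt1; split=> [[mu feas_mu]|[S feas_S]].
  by exists (cst_of_paths mu); apply: cst_of_paths_feasible.
by exists (vdp_of_cst S); apply: vdp_of_cst_feasible feas_S.
Qed.

(** For any feasible paths [mu], the extracted paths cost at most [S], which costs at most the tree
    built from [mu], which costs at most [mu]. *)
Lemma vdp_of_cst_optimal directed I (S : cst_candidate (cst_of_vdp directed I)) :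
  vdp_legal directed I -> 1 < vdp_num I ->
  optimal (P := ml_cap_steiner_tree directed) S ->
  optimal (P := ml_vdisj_path directed) (I := I) (vdp_of_cst S).
Proof.
move=> legal_I p_gt1 [feas_S min_S]; split; first exact: vdp_of_cst_feasible feas_S.
move=> mu feas_mu; have le1 := vdp_of_cst_cost legal_I p_gt1 feas_S.
have le2 := min_S _ (cst_of_paths_feasible directed p_gt1 feas_mu).
have le3 : (cst_cost (cst_of_paths mu : cst_candidate (cst_of_vdp directed I)) <= vdp_cost mu)%R.
  exact: cst_of_paths_cost.
exact: (le_trans le1 (le_trans le2 le3)).
Qed.

Theorem theorem4p4 (directed : bool) :
  @poly_reducible (ml_vdisj_path directed) (ml_cap_steiner_tree directed)
    (fun I : vdp_instance => 2 <= vdp_num I)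
    (fun (I : vdp_instance) (J : cst_instance) =>
       #|cst_terminals J| = vdp_num I ^ 2 /\
       forall e, e \in arcs (cst_graph J) -> cst_cap J e = vdp_num I).
Proof.
exists (cst_of_vdp directed), (fun I => @vdp_of_cst directed I); split.
- apply: (poly_time_poly_fun (poly_fun_tforward directed)) => I [_ p_gt1].
  exact: tforwardE.
- apply: (poly_time_poly_fun poly_fun_tbackward) => -[I S] _.
  exact: tbackwardE.
move=> I [legal_I p_gt1]; split.
- exact: new_legal.
- by split=> [|e _]; [exact: card_terminals | rewrite ffunE].
- exact: cst_of_vdp_feasible.
- by move=> S; apply: vdp_of_cst_optimal.
Qed.
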